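(* Let $f:\mathbb{R}^n\to\mathbb{R}$, $g:\mathbb{R}^n\to\mathbb{R}^m$, $h:\mathbb{R}^n\to\mathbb{R}^p$ be twice continuously differentiable, let $s<n$, and consider the cardinality constrained problem (CCOP) $$\min_x f(x)\quad\text{s.t.}\quad g(x)\le0,\ h(x)=0,\ \|x\|_0\le s.$$ Let $x^*$ be a local optimal solution of CCOP. Then: (i) Suppose that MSCQ holds at $x^*$ in direction $d\in\mathcal{C}(x^* )$. Then $x^*$ is M-stationary in direction $d$ and there exists an M-stationary $(d)$ multiplier $(\lambda^g,\lambda^h,\eta)$ such that $$d^T\nabla_x^2\mathcal{L}(x^*,\lambda^g,\lambda^h)d\ge0.$$ (ii) Let $d\in\mathcal{C}(x^* )$ and assume that CCOP-LICQ $(d)$ is fulfilled at $x^*$. Then there exists an S-stationary $(d)$ multiplier $(\lambda^g,\lambda^h,\eta)$ such that $d^T\nabla_x^2\mathcal{L}(x^*,\lambda^g,\lambda^h)d\ge0$. Conversely, let $x^*$ be a feasible solution of CCOP and suppose that for every $0\ne d\in\mathcal{C}(x^* )$ there exists an S-stationary $(d)$ multiplier $(\lambda^g,\lambda^h,\eta)$ such that $d^T\nabla_x^2\mathcal{L}(x^*,\lambda^g,\lambda^h)d>0$. Then $x^*$ is a strict local minimizer of CCOP.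
   Context: Notation. $\|x\|_0$ is the number of nonzero components of $x$; $I_\pm(x)=\{i : x_i\ne0\}$, $I_0(x)=\{i : x_i=0\}$; $e_i$ are the standard basis vectors. $\mathcal{I}_s$ is the family of subsets of $\{1,\dots,n\}$ of cardinality $s$, $\mathbb{R}_{\mathcal{I}}=\operatorname{span}\{e_i : i\in\mathcal{I}\}$, and $S=\bigcup_{\mathcal{I}\in\mathcal{I}_s}\mathbb{R}_{\mathcal{I}}=\{x : \|x\|_0\le s\}$. $\mathcal{F}$ is the feasible set of CCOP, $d_\Omega$ the distance function to $\Omega$, $\mathbb{B}$ the open unit ball, $\mathcal{I}_g(x^* )=\{i : g_i(x^* )=0\}$. Critical cone: $\mathcal{C}(x^* )$ is the set of $d\in\mathbb{R}^n$ with $\nabla g_i(x^* )d\le0$ for $i\in\mathcal{I}_g(x^* )$, $\nabla h_i(x^* )d=0$ for $i=1,\dots,p$, $d\in\bigcup_{I_\pm(x^* )\subseteq\mathcal{I}\in\mathcal{I}_s}\mathbb{R}_{\mathcal{I}}$, and $\nabla f(x^* )d\le0$. $\mathcal{I}_g^*(d)=\{i\in\mathcal{I}_g(x^* ) : \nabla g_i(x^* )d=0\}$. Stationarity: for feasible $x^*$ and $d\in\mathcal{C}(x^* )$, consider $(\lambda^g,\lambda^h,\eta)\in\mathbb{R}^m\times\mathbb{R}^p\times\mathbb{R}^n$ with $\lambda_i^g\ge0$ for $i\in\mathcal{I}_g^*(d)$, $\lambda^g_i=0$ for $i\notin\mathcal{I}_g^*(d)$, and $$\nabla f(x^* )+\sum_{i\in\mathcal{I}_g^*(d)}\lambda_i^g\nabla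 g_i(x^* )+\sum_{i=1}^p\lambda_i^h\nabla h_i(x^* )+\eta=0.$$ It is an S-stationary $(d)$ multiplier if, in addition: when $|I_\pm(x^* )\cup I_\pm(d)|=s$, $\eta_i=0$ for all $i\in I_\pm(x^* )\cup I_\pm(d)$; and when $|I_\pm(x^* )\cup I_\pm(d)|<s$, $\eta=0$. It is an M-stationary $(d)$ multiplier if, in addition, $\eta_i=0$ for all $i\in I_\pm(x^* )\cup I_\pm(d)$ and $\|\eta\|_0\le n-s$. $x^*$ is S-/M-stationary in direction $d$ if such a multiplier exists. MSCQ at $x^*$ in direction $d$: there exist $\alpha\ge0$, $\rho>0$, $\delta>0$ such that $d_{\mathcal{F}}(x)\le\alpha\bigl(\sum_{i=1}^m\max\{g_i(x),0\}+\sum_{i=1}^p|h_i(x)|+d_S(x)\bigr)$ for all $x\in x^*+V_{\rho,\delta}(d)$, where $V_{\rho,\delta}(d)=\{z\in\rho\mathbb{B} : \big\|\|d\|z-\|z\|d\big\|\le\delta\|z\|\|d\|\}$. CCOP-LICQ $(d)$ at $x^*$: the family $\{\nabla g_i(x^* )\}_{i\in\mathcal{I}_g(x^* )}\cup\{\nabla h_i(x^* )\}_{i=1}^p\cup\{e_i\}_{i\in I_0(x^* )\cap I_0(d)}$ is linearly independent. Lagrangian: $\mathcal{L}(x,\lambda^g,\lambda^h)=f(x)+\langle\lambda^g,g(x)\rangle+\langle\lambda^h,h(x)\rangle$. *)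

(* Defs.v *)
From mathcomp Require Import all_boot all_order all_algebra.
From mathcomp Require Import all_classical all_reals topology normedtype.
From mathcomp Require Import derive.
Set Implicit Arguments.
Unset Strict Implicit.
Unset Printing Implicit Defensive.

Import Order.TTheory GRing.Theory Num.Theory.
Import numFieldNormedType.Exports.
Local Open Scope ring_scope.

(* Vectors of R^n are row vectors.  The norm carried by the library structure
   on ['rV[R]_n] is the sup norm; it is only used through the topology and the
   notion of differentiability it induces.  Wherever a norm or a distance
   occurs explicitly, it is the Euclidean one. *)

Definition dotp (R : realType) (n : nat) (u v : 'rV[R]_n) : R :=
  \sum_(i < n) u 0 i * v 0 i.

Definition enorm (R : realType) (n : nat) (x : 'rV[R]_n) : R :=
  Num.sqrt (dotp x x).

(* [inf] of an empty set is 0; the sets to which distances are taken below are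
   nonempty (they contain a feasible point, respectively 0). *)
Definition edist_to (R : realType) (n : nat) (A : set 'rV[R]_n)
    (x : 'rV[R]_n) : R :=
  inf [set enorm (x - y) | y in A]%classic.

Definition basis_vec (R : realType) (n : nat) (i : 'I_n) : 'rV[R]_n :=
  delta_mx 0 i.

Definition component (R : realType) (n m : nat) (g : 'rV[R]_n -> 'rV[R]_m)
    (i : 'I_m) : 'rV[R]_n -> R :=
  fun x => g x 0 i.

Definition grad (R : realType) (n : nat) (f : 'rV[R]_n -> R)
    (x : 'rV[R]_n) : 'rV[R]_n :=
  \row_(j < n) 'D_(basis_vec R j) f x.

Definition hess (R : realType) (n : nat) (f : 'rV[R]_n -> R)
    (x : 'rV[R]_n) : 'M[R]_n :=
  'J (grad f) x.

Definition quad_form (R : realType) (n : nat) (A : 'M[R]_n)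
    (d : 'rV[R]_n) : R :=
  dotp (d *m A) d.

(* Twice continuous Frechet differentiability on the whole space. *)
Definition C2 (R : realType) (n : nat) (f : 'rV[R]_n -> R) : Prop :=
  [/\ forall x, differentiable f x,
      forall x, differentiable (grad f) x
    & continuous (hess f)].

Definition C2_map (R : realType) (n m : nat)
    (g : 'rV[R]_n -> 'rV[R]_m) : Prop :=
  forall i : 'I_m, C2 (component g i).

Definition supp (R : realType) (n : nat) (x : 'rV[R]_n) : {set 'I_n} :=
  [set i | x 0 i != 0]%SET.

Definition zeros (R : realType) (n : nat) (x : 'rV[R]_n) : {set 'I_n} :=
  [set i | x 0 i == 0]%SET.

Definition norm0 (R : realType) (n : nat) (x : 'rV[R]_n) : nat :=
  #|supp x|.

Definition coord_space (R : realType) (n : nat) (I : {set 'I_n}) :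
    {vspace 'rV[R]_n} :=
  <<[seq basis_vec R i | i <- enum I]>>%VS.

Definition sparse_set (R : realType) (n s : nat) : set 'rV[R]_n :=
  [set x | exists2 I : {set 'I_n}, #|I| = s & x \in coord_space R I]%classic.

Section CCOP.
Context (R : realType) (n m p s : nat).
Context (f : 'rV[R]_n -> R) (g : 'rV[R]_n -> 'rV[R]_m)
        (h : 'rV[R]_n -> 'rV[R]_p).

Definition feasible_set : set 'rV[R]_n :=
  [set x | [/\ forall i, component g i x <= 0,
               forall i, component h i x = 0
             & (norm0 x <= s)%N]]%classic.

Definition local_minimizer (xs : 'rV[R]_n) : Prop :=
  feasible_set xs /\
  (\forall x \near xs, feasible_set x -> f xs <= f x).

Definition strict_local_minimizer (xs : 'rV[R]_n) : Prop :=
  feasible_set xs /\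
  (\forall x \near xs, feasible_set x -> x <> xs -> f xs < f x).

Definition active (xs : 'rV[R]_n) : {set 'I_m} :=
  [set i | component g i xs == 0]%SET.

Definition active_dir (xs d : 'rV[R]_n) : {set 'I_m} :=
  [set i in active xs | dotp (grad (component g i) xs) d == 0]%SET.

Definition critical_cone (xs : 'rV[R]_n) : set 'rV[R]_n :=
  [set d | [/\ forall i, i \in active xs -> dotp (grad (component g i) xs) d <= 0,
               forall i, dotp (grad (component h i) xs) d = 0,
               exists I : {set 'I_n},
                 [/\ supp xs \subset I, #|I| = s & d \in coord_space R I]
             & dotp (grad f xs) d <= 0]]%classic.

Definition is_multiplier (xs d : 'rV[R]_n)
    (lg : 'rV[R]_m) (lh : 'rV[R]_p) (eta : 'rV[R]_n) : Prop :=
  [/\ forall i, i \in active_dir xs d -> 0 <= lg 0 i,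
      forall i, i \notin active_dir xs d -> lg 0 i = 0
    & grad f xs
      + \sum_(i in active_dir xs d) lg 0 i *: grad (component g i) xs
      + \sum_(i < p) lh 0 i *: grad (component h i) xs + eta = 0].

Definition S_multiplier (xs d : 'rV[R]_n)
    (lg : 'rV[R]_m) (lh : 'rV[R]_p) (eta : 'rV[R]_n) : Prop :=
  let J := (supp xs :|: supp d)%SET in
  [/\ is_multiplier xs d lg lh eta,
      #|J| = s -> forall i, i \in J -> eta 0 i = 0
    & (#|J| < s)%N -> eta = 0].

Definition M_multiplier (xs d : 'rV[R]_n)
    (lg : 'rV[R]_m) (lh : 'rV[R]_p) (eta : 'rV[R]_n) : Prop :=
  [/\ is_multiplier xs d lg lh eta,
      forall i, i \in (supp xs :|: supp d)%SET -> eta 0 i = 0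
    & (norm0 eta <= n - s)%N].

Definition M_stationary (xs d : 'rV[R]_n) : Prop :=
  exists lg lh eta, M_multiplier xs d lg lh eta.

Definition dir_nbhd (rho delta : R) (d : 'rV[R]_n) : set 'rV[R]_n :=
  [set z | enorm z < rho /\
           enorm (enorm d *: z - enorm z *: d)
             <= delta * enorm z * enorm d]%classic.

Definition MSCQ (xs d : 'rV[R]_n) : Prop :=
  exists alpha rho delta : R, [/\ 0 <= alpha, 0 < rho, 0 < delta &
    forall z, dir_nbhd rho delta d z ->
      let x := xs + z in
      edist_to feasible_set x <=
        alpha * (\sum_(i < m) Num.max (component g i x) 0
                 + \sum_(i < p) `|component h i x|
                 + edist_to (@sparse_set R n s) x)].

(* Freeness of a sequence, not of a set: two equal gradients with distinct
   indices are linearly dependent. *)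
Definition CCOP_LICQ (xs d : 'rV[R]_n) : Prop :=
  free ([seq grad (component g i) xs | i <- enum (active xs)]
        ++ [seq grad (component h i) xs | i <- enum 'I_p]
        ++ [seq basis_vec R i | i <- enum (zeros xs :&: zeros d)%SET]).

Definition lagrangian (lg : 'rV[R]_m) (lh : 'rV[R]_p) (x : 'rV[R]_n) : R :=
  f x + dotp lg (g x) + dotp lh (h x).

End CCOP.

(* Main.v *)
Require Import Defs.
From mathcomp Require Import all_boot all_order all_algebra.
From mathcomp Require Import all_classical all_reals topology normedtype.
From mathcomp Require Import landau derive realfun.
From mathcomp Require Import ring lra.

Set Implicit Arguments.
Unset Strict Implicit.
Unset Printing Implicit Defensive.

Import Order.TTheory GRing.Theory Num.Theory.
Import numFieldNormedType.Exports.
Local Open Scope classical_set_scope.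
Local Open Scope ring_scope.

(** Necessity.  The sparse set is a finite union of coordinate subspaces, the
    branches, and a direction [d] of the critical cone lies in some branch [I]
    with [supp xs] contained in [I] and [#|I| = s].  A multiplier whose [eta]
    vanishes on such an [I] is M-stationary, so it suffices to treat the
    nonlinear program restricted to one branch.

    Both constraint qualifications give the same thing there: in a directional
    neighbourhood of [xs] inside the branch, [f + K violation] is minimal at
    [xs] ([branch_penalty]).  Under MSCQ this follows by moving to a nearly
    closest feasible point, possibly in another branch, at a cost controlled by
    a Lipschitz constant of [f] ([MSCQ_branch_penalty]).  Under CCOP-LICQ the
    active constraints are solved for exactly near [xs] by a contraction built
    on a basis dual to their gradients ([local_solve],
    [LICQ_branch_penalty]).

    Exactness of the penalty is exploited along the arcs
    [xs + t d + t^2/2 w] with [w] in the branch.  Dividing by [t^2/2] and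
    letting [t] tend to [0] gives, for every [w], nonnegativity of
    [grad f . w + d^T f'' d] plus [K] times the positive parts of
    [grad g_i . w + d^T g_i'' d], over the constraints that are active in
    direction [d], and the absolute values of the same expressions for [h]
    ([penalty_second_order]).  This function of [w] is convex and piecewise
    linear.  Convex duality replaces each positive part or absolute value by a
    multiple of its argument while preserving nonnegativity
    ([branch_duality]); the linear part of the resulting affine function
    vanishes on the branch, which is stationarity, and its constant part is
    the second-order inequality, for the same multipliers.  The case [d = 0]
    is not special.

    Under CCOP-LICQ the vector [eta] does not depend on the branch
    ([LICQ_eta_coord]).  When [supp xs] and [supp d] together have fewer than [s]
    elements, every index belongs to some branch containing both supports, so
    [eta = 0] and the multiplier is S-stationary.

    Sufficiency.  If [xs] is not a strict local minimizer, feasible points of no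
    larger objective accumulate at [xs] in some direction [d], which is then
    critical.  Near [d] the supports of these points contain [supp xs] and
    [supp d], so the [eta] of an S-multiplier is orthogonal to the
    displacements.  The Lagrangian therefore does not increase along them and
    has no first-order term, which contradicts its positive curvature along
    [d] ([second_order_sufficient]). *)

(** * Inner product, norms and coordinate subspaces *)

Section InnerProduct.
Variables (R : realType) (n : nat).
Implicit Types (u v w x : 'rV[R]_n) (a t : R).

Lemma dotpC u v : dotp u v = dotp v u.
Proof. by apply: eq_bigr => i _; rewrite mulrC. Qed.

Lemma dotpDl u v w : dotp (u + v) w = dotp u w + dotp v w.
Proof. by rewrite -big_split; apply: eq_bigr => i _; rewrite mxE mulrDl. Qed.

Lemma dotpDr u v w : dotp u (v + w) = dotp u v + dotp u w.
Proof. by rewrite dotpC dotpDl !(dotpC _ u). Qed.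

Lemma dotpZl a u v : dotp (a *: u) v = a * dotp u v.
Proof. by rewrite mulr_sumr; apply: eq_bigr => i _; rewrite mxE mulrA. Qed.

Lemma dotpZr a u v : dotp u (a *: v) = a * dotp u v.
Proof. by rewrite dotpC dotpZl dotpC. Qed.

Lemma dotp0l u : dotp 0 u = 0.
Proof. by rewrite -(scale0r 0) dotpZl mul0r. Qed.

Lemma dotp0r u : dotp u 0 = 0.
Proof. by rewrite dotpC dotp0l. Qed.

Lemma dotpNl u v : dotp (- u) v = - dotp u v.
Proof. by rewrite -scaleN1r dotpZl mulN1r. Qed.

Lemma dotpNr u v : dotp u (- v) = - dotp u v.
Proof. by rewrite dotpC dotpNl dotpC. Qed.

Lemma dotpBl u v w : dotp (u - v) w = dotp u w - dotp v w.
Proof. by rewrite dotpDl dotpNl. Qed.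

Lemma dotpBr u v w : dotp u (v - w) = dotp u v - dotp u w.
Proof. by rewrite dotpDr dotpNr. Qed.

Lemma dotp_suml (T : Type) (r : seq T) (P : pred T) (F : T -> 'rV[R]_n) v :
  dotp (\sum_(i <- r | P i) F i) v = \sum_(i <- r | P i) dotp (F i) v.
Proof.
by elim/big_rec2: _ => [|i y1 y2 _ <-]; rewrite ?dotp0l // dotpDl.
Qed.

Lemma dotp_sumr (T : Type) (r : seq T) (P : pred T) (F : T -> 'rV[R]_n) v :
  dotp v (\sum_(i <- r | P i) F i) = \sum_(i <- r | P i) dotp v (F i).
Proof. by rewrite dotpC dotp_suml; apply: eq_bigr => i _; rewrite dotpC. Qed.

Lemma dotp_basis u i : dotp u (basis_vec R i) = u 0 i.
Proof.
rewrite /dotp (bigD1 i) //= big1 => [|j ji]; rewrite mxE !eqxx /=.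
  by rewrite mulr1 addr0.
by rewrite (negbTE ji) mulr0.
Qed.

Lemma norm_coord_le u i : `|u 0 i| <= `|u|.
Proof.
rewrite [leRHS]/Num.norm /= mx_normrE.
exact: (@le_bigmax _ _ _ 0 (fun ij : 'I_1 * 'I_n => `|u ij.1 ij.2|) (0, i)).
Qed.

Lemma norm_dotp_le u v : `|dotp u v| <= n%:R * (`|u| * `|v|).
Proof.
apply: (le_trans (ler_norm_sum _ _ _)).
rewrite mulr_natl -[X in _ *+ X](card_ord n) -sumr_const; apply: ler_sum => i _.
by rewrite normrM ler_pM // norm_coord_le.
Qed.

(** Analytic estimates are carried out in the sup norm, while [dir_nbhd] and the
    distances are Euclidean; this comparison is where the two meet. *)
Lemma norm_le_enorm u : `|u| <= enorm u.
Proof.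
rewrite [leLHS]/Num.norm /= mx_normrE.
apply/bigmax_leP; split => [|[i0 i] _ /=]; first exact: sqrtr_ge0.
rewrite (ord1 i0) -sqrtr_sqr ler_wsqrtr // /dotp (bigD1 i) //= -expr2.
by rewrite lerDl sumr_ge0 // => j _; rewrite -expr2 sqr_ge0.
Qed.

Lemma enorm_ge0 u : 0 <= enorm u.
Proof. exact: sqrtr_ge0. Qed.

Lemma enormZ a u : enorm (a *: u) = `|a| * enorm u.
Proof.
rewrite /enorm dotpZl dotpZr mulrA -expr2.
by rewrite sqrtrM ?sqr_ge0 // sqrtr_sqr.
Qed.

Lemma enorm0 : enorm (0 : 'rV[R]_n) = 0.
Proof. by rewrite /enorm dotp0l sqrtr0. Qed.

Lemma coord_spaceP (I : {set 'I_n}) u :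
  reflect (forall i, i \notin I -> u 0 i = 0) (u \in coord_space R I).
Proof.
apply: (iffP idP) => [uI i iI|u0].
  pose X := in_tuple [seq basis_vec R j | j <- enum I].
  rewrite (coord_span (uI : u \in <<X>>%VS)) summxE big1 // => k _.
  have /mapP[j] : X`_k \in X by rewrite mem_nth // size_tuple.
  rewrite mem_enum => jI ->; rewrite !mxE eqxx /=.
  by case: eqP iI jI => [->|] => [/negP|]; rewrite ?mulr0.
rewrite (row_sum_delta u); apply: rpred_sum => i _.
have [iI|/u0 ->] := boolP (i \in I); last by rewrite scale0r rpred0.
by apply/rpredZ/memv_span/map_f; rewrite mem_enum.
Qed.

Lemma coord_space_supp (I : {set 'I_n}) u :
  (u \in coord_space R I) = (supp u \subset I).
Proof.
apply/coord_spaceP/fintype.subsetP => [u0 i|sI i iI].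
  by rewrite inE; apply: contra_neqT => /u0.
by apply/eqP; apply: contraNT iI => ui; apply: sI; rewrite inE.
Qed.

Lemma cvg_sumr (T : Type) (F : set_system T) {FF : Filter F} (I : Type)
    (r : seq I) (P : pred I) (u : I -> T -> R) (l : I -> R) :
  (forall i, P i -> u i x @[x --> F] --> l i) ->
  (\sum_(i <- r | P i) u i x) @[x --> F] --> \sum_(i <- r | P i) l i.
Proof. by apply: cvg_big; exact: add_continuous. Qed.

Lemma cvg_dotp (T : Type) (F : set_system T) {FF : Filter F}
    (U V : T -> 'rV[R]_n) u v :
  U x @[x --> F] --> u -> V x @[x --> F] --> v ->
  dotp (U x) (V x) @[x --> F] --> dotp u v.
Proof.
move=> Uu Vv; apply: cvg_sumr => i _; apply: cvgM.
  apply: (@continuous_cvg _ _ _ _ _ _ (fun M : 'rV[R]_n => M 0 i)) => //.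
  exact: coord_continuous.
apply: (@continuous_cvg _ _ _ _ _ _ (fun M : 'rV[R]_n => M 0 i)) => //.
exact: coord_continuous.
Qed.

Lemma cvg_enorm (T : Type) (F : set_system T) {FF : Filter F}
    (U : T -> 'rV[R]_n) u :
  U x @[x --> F] --> u -> enorm (U x) @[x --> F] --> enorm u.
Proof.
move=> Uu; apply: (@continuous_cvg _ _ _ _ _ _ (fun y : R => Num.sqrt y)).
  exact: sqrt_continuous.
exact: cvg_dotp.
Qed.

Lemma cvg_max0 (T : Type) (F : set_system T) {FF : Filter F}
    (U : T -> R) (a : R) :
  U x @[x --> F] --> a -> Num.max (U x) 0 @[x --> F] --> Num.max a 0.
Proof.
move=> Ua; apply: (@continuous_cvg _ _ _ _ _ _ (fun y : R => Num.max y 0)) => //.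
by apply: continuous_max; [exact: cvg_id|exact: cvg_cst].
Qed.

End InnerProduct.

(** * Mean value and Taylor estimates *)

Section Calculus.
Variables (R : realType) (n : nat).
Implicit Types (f : 'rV[R]_n -> R) (x z d : 'rV[R]_n).

Lemma ler_mul_divS (e : R) : 0 < e -> n%:R * (e / n.+1%:R) <= e.
Proof.
move=> /ltW e0; rewrite mulrCA -[leRHS]mulr1 ler_wpM2l //.
by rewrite ler_pdivrMr ?ltr0n // mul1r ler_nat.
Qed.

Lemma diff_grad f x z : differentiable f x -> 'd f x z = dotp (grad f x) z.
Proof.
move=> df; rewrite {1}(row_sum_delta z) linear_sum; apply: eq_bigr => i _.
by rewrite linearZ /= mxE deriveE // mulrC.
Qed.

Lemma is_derive_line f x z t : differentiable f (x + t *: z) ->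
  is_derive t 1 (fun u : R => f (x + u *: z)) (dotp (grad f (x + t *: z)) z).
Proof.
move=> df.
have dl : is_diff t (fun u : R => x + u *: z) (fun u => u *: z).
  apply: is_diff_eq; by rewrite add0r.
have dl' : differentiable (fun u : R => x + u *: z) t by exact: ex_diff.
have dc : differentiable (f \o (fun u : R => x + u *: z)) t.
  by exact: differentiable_comp.
apply: DeriveDef; first exact/diff_derivable.
rewrite deriveE // diff_comp //.
by rewrite /= [X in 'd f _ X](_ : _ = z) ?diff_grad // diff_val /= scale1r.
Qed.

(** The remainder estimates below are all instances of the mean value theorem on
    a segment, applied to [f] minus a model [q] of it: [q] constant for first
    order, [q] quadratic for second order. *)
Lemma line_mvt f (q dq : R -> R) x z : (forall y, differentiable f y) ->
    (forall t : R, is_derive t 1 q (dq t)) ->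
  exists2 c : R, 0 <= c <= 1 &
    f (x + z) - f x - (q 1 - q 0) = dotp (grad f (x + c *: z)) z - dq c.
Proof.
move=> df dq_.
pose F := (fun u : R => f (x + u *: z)) - q.
have dF (t : R) : is_derive t 1 F (dotp (grad f (x + t *: z)) z - dq t).
  apply: is_deriveB; exact: is_derive_line.
have [|c c01] := @MVT_segment R F _ 0 1 ler01 (fun t _ => dF t).
  apply: continuous_subspaceT => t.
  by apply/differentiable_continuous/derivable1_diffP; exact: ex_derive.
rewrite subr0 mulr1 /F !fctE scale1r scale0r addr0 => E.
exists c; first by move: c01; rewrite in_itv.
by rewrite -E; ring.
Qed.

Lemma mean_value f x z : (forall y, differentiable f y) ->
  exists2 c : R, 0 <= c <= 1 & f (x + z) - f x = dotp (grad f (x + c *: z)) z.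
Proof.
move=> df; have [c c01] := @line_mvt f (cst 0) (cst 0) x z df (fun t => is_derive_cst _ _ _).
by rewrite /= !subr0; exists c.
Qed.

(** Differentiability at [x] only compares values with [f x]; here both end points
    vary.  Balls are convex, so the intermediate point of the mean value theorem
    stays near [x], where the gradient is almost constant. *)
Lemma strict_diff f x (e : R) : (forall y, differentiable f y) ->
    {for x, continuous (grad f)} -> 0 < e ->
  exists2 r : R, 0 < r & forall y z, `|y - x| < r -> `|y + z - x| < r ->
    `|f (y + z) - f y - dotp (grad f x) z| <= e * `|z|.
Proof.
move=> df cg e0.
have e1 : 0 < e / n.+1%:R by rewrite divr_gt0 ?ltr0n.
have /cvgrPdist_lt/(_ _ e1)/nbhs_normP[r /= r0 rP] := cg.
exists r => // y z yr yzr.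
have [c /andP[c0 c1] ->] := mean_value y z df.
rewrite -dotpBl; apply: le_trans (norm_dotp_le _ _) _.
rewrite mulrA ler_wpM2r ?normr_ge0 //.
have cr : `|x - (y + c *: z)| < r.
  rewrite (_ : x - _ = - ((1 - c) *: (y - x) + c *: (y + z - x))); last first.
    rewrite scalerBl scale1r !scalerBr scalerDr.
    by rewrite -[in RHS](addrA (c *: y)) opprD !opprB; apply/rowP=> i; rewrite !mxE; ring.
  rewrite normrN; apply: le_lt_trans (ler_normD _ _) _.
  rewrite !normrZ !ger0_norm ?subr_ge0 //.
  have [->|cn0] := eqVneq c 0; first by rewrite subr0 mul1r mul0r addr0.
  have cgt : 0 < c by rewrite lt_neqAle eq_sym cn0.
  have : (1 - c) * `|y - x| <= (1 - c) * r by rewrite ler_wpM2l ?subr_ge0 // ltW.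
  have : c * `|y + z - x| < c * r by rewrite ltr_pM2l.
  lra.
have := ltW (rP _ cr); rewrite distrC => H.
apply: le_trans (ler_wpM2l (ler0n _ _) H) _.
exact: ler_mul_divS.
Qed.

Lemma loc_lipschitz f x : (forall y, differentiable f y) ->
    {for x, continuous (grad f)} ->
  exists2 r : R, 0 < r & exists2 L : R, 0 < L &
    forall y y', `|y - x| < r -> `|y' - x| < r -> `|f y' - f y| <= L * `|y' - y|.
Proof.
move=> df cg; have [r r0 rP] := strict_diff df cg ltr01.
exists r => //; exists (1 + n%:R * `|grad f x|).
  by rewrite ltr_wpDr ?mulr_ge0.
move=> y y' yr yr'; have := rP y (y' - y) yr.
rewrite subrKC => /(_ yr') H.
have := norm_dotp_le (grad f x) (y' - y).
have := ler_normD (f y' - f y - dotp (grad f x) (y' - y)) (dotp (grad f x) (y' - y)).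
rewrite subrK; set a := dotp _ _ in H *; rewrite mulrA; lra.
Qed.

(** The regularity behind the second-order Taylor formula with Peano remainder:
    it makes [hess] a genuine derivative of [grad]. *)
Definition twice_diff f :=
  (forall x, differentiable f x) /\ (forall x, differentiable (grad f) x).

Lemma hessE f x d : differentiable (grad f) x -> d *m hess f x = 'd (grad f) x d.
Proof. by move=> dg; rewrite -deriveEjacobian // deriveE. Qed.

Lemma diff_remainder (m : nat) (F : 'rV[R]_n -> 'rV[R]_m) x (e : R) :
    differentiable F x -> 0 < e ->
  exists2 r : R, 0 < r & forall z, `|z| < r ->
    `|F (x + z) - F x - 'd F x z| <= e * `|z|.
Proof.
move=> /diff_locally dF e0; have /eqaddoP/(_ e e0) := dF.
move=> /nbhs_normP[r /= r0 rP]; exists r => // z zr.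
have := rP z; rewrite /= sub0r normrN => /(_ zr).
by rewrite /cst !fctE /= (addrC z x) opprD addrA.
Qed.

Lemma quad_formE f x d : twice_diff f ->
  quad_form (hess f x) d = dotp ('d (grad f) x d) d.
Proof. by move=> f2; rewrite /quad_form hessE //; exact: f2.2. Qed.

(** After the quadratic model is subtracted, the mean value theorem leaves the
    linearization error of the gradient at an intermediate point. *)
Lemma taylor2 f x (e : R) : twice_diff f -> 0 < e ->
  exists2 r : R, 0 < r & forall z, `|z| < r ->
    `|f (x + z) - f x - dotp (grad f x) z - quad_form (hess f x) z / 2|
      <= e * `|z| ^+ 2.
Proof.
move=> [df dg] e0.
have e1 : 0 < e / n.+1%:R by rewrite divr_gt0 ?ltr0n.
have [r r0 rP] := diff_remainder (dg x) e1.
exists r => // z zr.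
pose a := dotp (grad f x) z; pose b := quad_form (hess f x) z.
have dq (t : R) : is_derive t 1 (fun u : R => a * u + (b / 2) * u ^+ 2)
    (a + b * t).
  apply: is_derive_eq.
  by rewrite /GRing.scale /=; field.
have [c /andP[c0 c1]] := line_mvt x z df dq.
rewrite expr1n expr0n /= !mulr0 addr0 subr0 !mulr1 opprD addrA => ->.
rewrite (_ : _ - _ =
    dotp (grad f (x + c *: z) - grad f x - 'd (grad f) x (c *: z)) z); last first.
  rewrite !dotpBl linearZ /= dotpZl -hessE // -/a /b /quad_form; ring.
apply: le_trans (norm_dotp_le _ _) _.
have cz : `|c *: z| <= `|z| by rewrite normrZ ger0_norm // ler_piMl.
have H := le_trans (rP _ (le_lt_trans cz zr)) (ler_wpM2l (ltW e1) cz).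
rewrite expr2 mulrA mulrA ler_wpM2r //.
apply: le_trans (ler_wpM2l (ler0n _ _) H) _.
by rewrite mulrA ler_wpM2r // ler_mul_divS.
Qed.

(** The displacement is [t d + t^2/2 w].  Its second-order part [t^2/2 w]
    contributes to the gradient term at order [t^2], but to the Hessian term only
    at order [t^3]. *)
Lemma second_order_arc f x d w : twice_diff f ->
  (f (x + t *: (d + (t / 2) *: w)) - f x - t * dotp (grad f x) d)
      / (t ^+ 2 / 2) @[t --> 0^'+]
    --> dotp (grad f x) w + quad_form (hess f x) d.
Proof.
move=> f2; set g := grad f x; set H := hess f x.
pose v (t : R) := d + (t / 2) *: w.
pose A := (dotp (d *m H) w + dotp (w *m H) d) / 2.
pose B := quad_form H w / 4.
have quadv t : quad_form H (v t) = quad_form H d + (t * A + t ^+ 2 * B).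
  rewrite /quad_form /v mulmxDl -scalemxAl !(dotpDl, dotpDr) !(dotpZl, dotpZr).
  by rewrite /A /B /quad_form; field.
(* for t <= 1 the displacement has norm at most t M *)
pose M := `|d| + `|w| + 1.
have M0 : 0 < M by apply: ltr_wpDl => //; rewrite addr_ge0.
apply/cvgrPdist_le => e e0.
have e1 : 0 < e / (4 * M ^+ 2) by rewrite divr_gt0 // mulr_gt0 ?exprn_gt0.
have [r r0 rP] := taylor2 x f2 e1.
have C0 : 0 < `|A| + `|B| + 1 by apply: ltr_wpDl => //; rewrite addr_ge0.
near=> t.
have t0 : 0 < t by near: t; exact: nbhs_right_gt.
have t1 : t < 1 by near: t; exact: nbhs_right_lt.
have tr : t < r / M by near: t; apply: nbhs_right_lt; rewrite divr_gt0.
have te : t < (e / 2) / (`|A| + `|B| + 1).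
  by near: t; apply: nbhs_right_lt; rewrite !divr_gt0.
have vM : `|t *: v t| <= t * M.
  rewrite normrZ gtr0_norm // ler_wpM2l ?(ltW t0) // /v.
  apply: le_trans (ler_normD _ _) _; rewrite /M -addrA lerD2l normrZ.
  rewrite gtr0_norm ?divr_gt0 //.
  have : t / 2 * `|w| <= 1 * `|w| by rewrite ler_wpM2r //; lra.
  lra.
have := rP (t *: v t); rewrite (le_lt_trans vM) -?ltr_pdivlMr // => /(_ isT).
rewrite -/g -/H; set F := f _ - f x => HF.
have {HF} HF : `|F - dotp g (t *: v t) - quad_form H (t *: v t) / 2|
    <= e * t ^+ 2 / 4.
  apply: le_trans HF _.
  rewrite (_ : e * t ^+ 2 / 4 = e / (4 * M ^+ 2) * (t * M) ^+ 2).
    by rewrite ler_wpM2l ?(ltW e1) // ler_pXn2r // nnegrE ?normr_ge0 // mulr_ge0 ?ltW.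
  by field; rewrite gt_eqF.
have qZ : quad_form H (t *: v t) = t ^+ 2 * quad_form H (v t).
  by rewrite /quad_form -scalemxAl dotpZl dotpZr; ring.
move: HF; rewrite qZ quadv dotpZr /v dotpDr dotpZr => HF.
set rem := F - _ - _ in HF.
have -> : dotp g w + quad_form H d - (F - t * dotp g d) / (t ^+ 2 / 2)
    = - (rem / (t ^+ 2 / 2)) - (t * A + t ^+ 2 * B).
  by rewrite /rem; field; rewrite gt_eqF.
have t2 : 0 < t ^+ 2 / 2 by rewrite divr_gt0 // exprn_gt0.
have h1 : `|rem / (t ^+ 2 / 2)| <= e / 2.
  rewrite normrM [X in _ * X]ger0_norm; last by rewrite invr_ge0 ltW.
  by rewrite ler_pdivrMr //; lra.
have h2 : `|t * A + t ^+ 2 * B| <= e / 2.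
  apply: le_trans (ler_normD _ _) _; rewrite (normrM t) (normrM (t ^+ 2)) (gtr0_norm t0).
  rewrite (gtr0_norm (exprn_gt0 2 t0)).
  have tt : t ^+ 2 * `|B| <= t * `|B|.
    by rewrite ler_wpM2r // expr2 ler_piMr // ltW.
  by move: te; rewrite ltr_pdivlMr // => te; lra.
apply: le_trans (ler_normB _ _) _; rewrite normrN; lra.
Unshelve. all: by end_near. Qed.

Lemma grad_comb f g (a : R) : (forall x, differentiable f x) ->
    (forall x, differentiable g x) ->
  grad (fun x => f x + a * g x) = fun x => grad f x + a *: grad g x.
Proof.
move=> df dg; apply/funext => x; apply/rowP => j; rewrite !mxE.
have dag : differentiable (a \*: g) x by exact: differentiableZ.
rewrite (_ : (fun y => _) = f + a \*: g) //.
rewrite deriveD ?deriveZ //; exact: diff_derivable.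
Qed.

Lemma twice_diff_comb f g (a : R) : twice_diff f -> twice_diff g ->
  twice_diff (fun x => f x + a * g x).
Proof.
move=> [df ddf] [dg ddg]; split=> x.
  have dag : differentiable (a \*: g) x by exact: differentiableZ.
  exact: (differentiableD (df x) dag).
rewrite (grad_comb a df dg).
have dag : differentiable (a \*: grad g) x by exact: differentiableZ.
exact: (differentiableD (ddf x) dag).
Qed.

Lemma quad_form_comb f g (a : R) x d : twice_diff f -> twice_diff g ->
  quad_form (hess (fun x => f x + a * g x) x) d =
    quad_form (hess f x) d + a * quad_form (hess g x) d.
Proof.
move=> f2 g2; have fg2 := twice_diff_comb a f2 g2.
rewrite [LHS](quad_formE x d fg2).
rewrite [X in _ = X + _](quad_formE x d f2) [X in _ = _ + _ * X](quad_formE x d g2).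
rewrite (grad_comb a f2.1 g2.1).
have dag : differentiable (a \*: grad g) x by apply: differentiableZ; exact: g2.2.
have -> : (fun y => grad f y + a *: grad g y) = grad f + a \*: grad g by [].
have E1 := congr1 (fun F => F d) (diffD (f2.2 x) dag).
have E2 := congr1 (fun F => F d) (diffZ a (g2.2 x)).
have E := etrans E1 (congr1 (fun z => 'd (grad f) x d + z) E2).
apply: etrans (congr1 (fun z => dotp z d) E) _.
by rewrite dotpDl dotpZl.
Qed.

(** Summands are added one at a time because each step needs the partial sum to
    be [twice_diff]; the Lagrangian is obtained by two applications. *)
Lemma twice_diff_sum (I : finType) (G : I -> 'rV[R]_n -> R) f (a : I -> R) (r : seq I) :
    twice_diff f -> (forall i, twice_diff (G i)) ->
  let F := fun x => f x + \sum_(i <- r) a i * G i x in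
  [/\ twice_diff F,
      forall x, grad F x = grad f x + \sum_(i <- r) a i *: grad (G i) x
    & forall x d, quad_form (hess F x) d =
        quad_form (hess f x) d + \sum_(i <- r) a i * quad_form (hess (G i) x) d].
Proof.
move=> f2 G2; elim: r => [|i r [F2 gF hF]] /=.
  have -> : (fun x => f x + \sum_(i <- [::]) a i * G i x) = f.
    by apply/funext => x; rewrite big_nil addr0.
  by split=> // x; [|move=> d]; rewrite big_nil addr0.
pose F x := f x + \sum_(i <- r) a i * G i x.
have -> : (fun x => f x + \sum_(i <- i :: r) a i * G i x) =
    fun x => F x + a i * G i x.
  by apply/funext => x; rewrite big_cons addrCA addrC.
split; first exact: twice_diff_comb.
  move=> x; rewrite (grad_comb (a i) F2.1 (G2 i).1) gF big_cons.
  by rewrite [in RHS]addrCA [in RHS]addrC.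
move=> x d; apply: etrans (quad_form_comb (a i) x d F2 (G2 i)) _.
apply: etrans (congr1 (fun y => y + _) (hF x d)) _.
rewrite big_cons.
by rewrite [in RHS]addrCA [in RHS]addrC.
Qed.

End Calculus.

(** * Multipliers by convex duality *)

Section ConvexMultipliers.
Variables (R : realType) (V : lmodType R).
Implicit Types (p l : V -> R) (K : R).

Definition convex_fun p := forall (a : R) u v, 0 <= a <= 1 ->
  p (a *: u + (1 - a) *: v) <= a * p u + (1 - a) * p v.

Definition affine_fun l := forall (a : R) u v,
  l (a *: u + (1 - a) *: v) = a * l u + (1 - a) * l v.

Lemma affine_sum (I : Type) (r : seq I) (c : I -> R) (l : I -> V -> R) :
  (forall i, affine_fun (l i)) -> affine_fun (fun w => \sum_(i <- r) c i * l i w).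
Proof.
move=> al a u v; rewrite !mulr_sumr -big_split; apply: eq_bigr => i _ /=.
by rewrite al; ring.
Qed.

Lemma convexD_affine p l : convex_fun p -> affine_fun l ->
  convex_fun (fun w => p w + l w).
Proof. by move=> cp al a u v a01; rewrite al; have := cp a u v a01; lra. Qed.

Lemma convexD p q : convex_fun p -> convex_fun q ->
  convex_fun (fun w => p w + q w).
Proof.
by move=> cp cq a u v a01; have := cp a u v a01; have := cq a u v a01; lra.
Qed.

Lemma convex_max0 l K : 0 <= K -> affine_fun l ->
  convex_fun (fun w => K * Num.max (l w) 0).
Proof.
move=> K0 al a u v /andP[a0 a1]; rewrite al (mulrCA a K) (mulrCA (1 - a) K) -mulrDr.
rewrite ler_wpM2l // ge_max; apply/andP; split.
  by rewrite lerD // ler_wpM2l ?subr_ge0 // le_max lexx.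
by rewrite addr_ge0 // mulr_ge0 ?subr_ge0 // le_max lexx orbT.
Qed.

Lemma convex_sum_abs (I : Type) (r : seq I) (l : I -> V -> R) K :
    0 <= K -> (forall i, affine_fun (l i)) ->
  convex_fun (fun w => \sum_(i <- r) K * `|l i w|).
Proof.
move=> K0 al a u v /andP[a0 a1]; rewrite !mulr_sumr -big_split /=.
apply: ler_sum => i _; rewrite al (mulrCA a K) (mulrCA (1 - a) K) -mulrDr.
rewrite ler_wpM2l //; apply: le_trans (ler_normD _ _) _.
by rewrite !normrM (ger0_norm a0) (@ger0_norm _ (1 - a)) // subr_ge0.
Qed.

(** The admissible multipliers form an interval: points where [l] is positive
    bound them from below, points where it is negative from above, and
    convexity of [p] on the segment crossing the zero set of [l] makes the
    bounds compatible. *)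
Lemma max0_multiplier p l K : 0 <= K -> convex_fun p -> affine_fun l ->
    (forall w, 0 <= p w + K * Num.max (l w) 0) ->
  exists2 a : R, 0 <= a & forall w, 0 <= p w + a * l w.
Proof.
move=> K0 cp al H.
pose E := [set y : R | y = 0 \/ exists2 w, 0 < l w & y = - p w / l w].
have bE u : l u < 0 -> ubound E (p u / - l u).
  move=> lu y [->|[w lw ->]].
    have := H u; rewrite max_r ?(ltW lu) // mulr0 addr0 => pu.
    by rewrite divr_ge0 // oppr_ge0 ltW.
  rewrite ler_pdivlMr ?oppr_gt0 // mulrAC ler_pdivrMr //.
  (* the weight for which [l] vanishes at [a w + (1 - a) u] *)
  pose a := - l u / (l w - l u).
  have D0 : 0 < l w - l u by rewrite subr_gt0 (lt_trans lu).
  have a01 : 0 <= a <= 1.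
    rewrite /a divr_ge0 ?oppr_ge0 ?(ltW lu) ?(ltW D0) //= ler_pdivrMr //; lra.
  have l0 : l (a *: w + (1 - a) *: u) = 0.
    by rewrite al /a; field; rewrite gt_eqF.
  have := H (a *: w + (1 - a) *: u); rewrite l0 maxxx mulr0 addr0 => H0.
  have := le_trans H0 (cp a w u a01).
  have -> : a * p w + (1 - a) * p u = (- l u * p w + l w * p u) / (l w - l u).
    by rewrite /a; field; rewrite gt_eqF.
  by rewrite pmulr_lge0 ?invr_gt0 //; lra.
have bK : ubound E K.
  move=> y [->|[w lw ->]] //; rewrite ler_pdivrMr //.
  by have := H w; rewrite max_l ?(ltW lw) //; lra.
have supE : has_sup E by split; [exists 0; left|exists K].
have E0 : E 0 by left.
exists (sup E); first exact: ub_le_sup supE.2 _ E0.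
move=> w; case: (ltrgtP (l w) 0) => lw.
- have := ge_sup supE.1 (bE w lw).
  by rewrite ler_pdivlMr ?oppr_gt0 //; lra.
- have : - p w / l w <= sup E by apply: ub_le_sup supE.2 _ _; right; exists w.
  by rewrite ler_pdivrMr //; lra.
- by have := H w; rewrite lw maxxx !mulr0.
Qed.

(** The terms are eliminated one by one; those still to be treated are part of
    the convex function [p], as are those already made affine. *)
Lemma sum_max0_multipliers (I : eqType) (r : seq I) (l : I -> V -> R) p K :
    0 <= K -> uniq r -> convex_fun p -> (forall i, affine_fun (l i)) ->
    (forall w, 0 <= p w + \sum_(i <- r) K * Num.max (l i w) 0) ->
  exists2 a : I -> R, (forall i, 0 <= a i) &
    forall w, 0 <= p w + \sum_(i <- r) a i * l i w.
Proof.
move=> K0; elim: r p => [|i r IH] p /=.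
  move=> _ _ _ H; exists (fun=> 0) => // w.
  by have := H w; rewrite !big_nil.
move=> /andP[ir ur] cp al H.
have [|w|a a0 Ha] := IH (fun w => p w + K * Num.max (l i w) 0) ur _ al.
- exact/convexD/convex_max0.
- by have := H w; rewrite big_cons addrA.
have cq := convexD_affine cp (affine_sum r a al).
have [w|b b0 Hb] := @max0_multiplier _ _ K K0 cq (al i).
  by rewrite addrAC.
exists (fun j => if j == i then b else a j) => [j|w]; first by case: eqP.
rewrite big_cons eqxx [X in b * _ + X](_ : _ = \sum_(j <- r) a j * l j w).
  by rewrite [b * _ + _]addrC addrA; exact: Hb.
rewrite !big_seq; apply: eq_bigr => j jr.
by case: eqP jr ir => // -> ->.
Qed.

(** Reduces to positive parts through [`|y| = max (2 y) 0 - y]. *)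
Lemma sum_abs_multipliers (I : eqType) (r : seq I) (l : I -> V -> R) p K :
    0 <= K -> uniq r -> convex_fun p -> (forall i, affine_fun (l i)) ->
    (forall w, 0 <= p w + \sum_(i <- r) K * `|l i w|) ->
  exists a : I -> R, forall w, 0 <= p w + \sum_(i <- r) a i * l i w.
Proof.
move=> K0 ur cp al H.
have al2 i : affine_fun (fun w => 2 * l i w).
  by move=> a u v; rewrite al; ring.
have cq := convexD_affine cp (affine_sum r (fun=> - K) al).
have [w|a a0 Ha] := sum_max0_multipliers K0 ur cq al2.
  rewrite -addrA -big_split /=; have := H w; congr (0 <= _ + _).
  apply: eq_bigr => i _; case: (ler0P (l i w)) => li.
    by rewrite max_r ?ler0_norm //; [ring|rewrite mulr_ge0_le0].
  by rewrite max_l; [ring|rewrite mulr_ge0 // ltW].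
exists (fun i => 2 * a i - K) => w.
have := Ha w; rewrite -addrA -big_split /=; congr (0 <= _ + _).
by apply: eq_bigr => i _; ring.
Qed.

End ConvexMultipliers.

Section BranchMultipliers.
Variables (R : realType) (n : nat) (I : {set 'I_n}).

(** Precomposition with this projection turns inequalities on the coordinate
    subspace of [I] into inequalities on the whole space. *)
Definition mask (w : 'rV[R]_n) : 'rV[R]_n :=
  \row_i (if i \in I then w 0 i else 0).

Lemma affine_dotp_mask (c : 'rV[R]_n) (b : R) :
  affine_fun (fun w => dotp c (mask w) + b).
Proof.
move=> a u v; rewrite (_ : mask _ = a *: mask u + (1 - a) *: mask v).
  by rewrite dotpDr !dotpZr; ring.
by apply/rowP => i; rewrite !mxE; case: ifP => // _; ring.
Qed.

Lemma mask_coord_space w : mask w \in coord_space R I.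
Proof. by apply/coord_spaceP => i /negbTE iI; rewrite mxE iI. Qed.

Lemma mask_basis i (t : R) : i \in I -> mask (t *: basis_vec R i) = t *: basis_vec R i.
Proof.
move=> iI; apply/rowP => j; rewrite !mxE eqxx /=.
by case: ifPn => //; case: eqP => [->|]; rewrite ?iI ?mulr0.
Qed.

(** Once every positive part and absolute value has been replaced by a multiple
    of its argument, an affine function that is nonnegative on a subspace
    remains; its linear part must vanish there and its constant part is its
    value at [0]. *)
Lemma branch_duality (S T : finType) (A : {set S}) (c : 'rV[R]_n) (k : R)
    (a : S -> 'rV[R]_n) (b : S -> R) (e : T -> 'rV[R]_n) (q : T -> R) (K : R) :
    0 <= K ->
    (forall w, w \in coord_space R I ->
       0 <= dotp c w + k + K * (\sum_(i in A) Num.max (dotp (a i) w + b i) 0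
                                + \sum_j `|dotp (e j) w + q j|)) ->
  exists l : S -> R, exists m : T -> R, [/\ forall i, 0 <= l i,
    forall i, i \in I ->
      (c + \sum_(i in A) l i *: a i + \sum_j m j *: e j) 0 i = 0
    & 0 <= k + \sum_(i in A) l i * b i + \sum_j m j * q j].
Proof.
move=> K0 H.
pose la i w := dotp (a i) (mask w) + b i.
pose le j w := dotp (e j) (mask w) + q j.
have ala i : affine_fun (la i) by exact: affine_dotp_mask.
have ale i : affine_fun (le i) by exact: affine_dotp_mask.
have cc : convex_fun (fun w => dotp c (mask w) + k).
  by move=> t u v _; rewrite (affine_dotp_mask c k).
have [|w|l l0 Hl] := @sum_max0_multipliers R _ _ (enum A) la
    (fun w => (dotp c (mask w) + k) + \sum_(j <- enum T) K * `|le j w|) K K0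
    (enum_uniq _) _ ala.
- apply: convexD => //; exact: convex_sum_abs.
- have := H _ (mask_coord_space w); rewrite mulrDr !mulr_sumr !big_enum /=.
  by rewrite addrA addrAC.
have cq := convexD_affine cc (affine_sum (enum A) l ala).
have [w|m Hm] := @sum_abs_multipliers R _ _ (enum T) le _ K K0
    (enum_uniq _) cq ale.
  by have := Hl w; rewrite addrAC.
have {}Hm w : 0 <= dotp (c + \sum_(i in A) l i *: a i + \sum_j m j *: e j) (mask w)
    + (k + \sum_(i in A) l i * b i + \sum_j m j * q j).
  have := Hm w; rewrite !big_enum /= /la /le; congr (0 <= _).
  rewrite !dotpDl !dotp_suml.
  under [X in _ + _ + X + _]eq_bigr do rewrite mulrDr -dotpZl.
  under [X in _ + X = _]eq_bigr do rewrite mulrDr -dotpZl.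
  by rewrite !big_split /=; ring.
set C := c + _ + _ in Hm; set k' := k + _ + _ in Hm.
exists l, m; split=> //; last first.
  have := Hm 0; rewrite (_ : mask 0 = 0) ?dotp0r ?add0r //.
  by apply/rowP => i; rewrite !mxE if_same.
move=> i iI; rewrite -/C; apply/eqP/negP => /negP Ci.
(* a multiple of the basis vector at which the affine function equals -1 *)
have := Hm ((- (k' + 1) / C 0 i) *: basis_vec R i).
by rewrite mask_basis // dotpZr dotp_basis divfK //; lra.
Qed.

End BranchMultipliers.

(** * Arcs tangent to a direction *)

Section Arcs.
Variables (R : realType) (n : nat).
Implicit Types (f : 'rV[R]_n -> R) (x d w : 'rV[R]_n).

Lemma cvg_arc d w : d + (t / 2) *: w @[t --> (0 : R)^'+] --> d.
Proof.
apply/cvgrPdist_le => e e0.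
have C0 : 0 < `|w| + 1 by apply: ltr_wpDl.
near=> t.
have t0 : 0 < t by near: t; exact: nbhs_right_gt.
have te : t < e / (`|w| + 1) by near: t; apply: nbhs_right_lt; rewrite divr_gt0.
rewrite opprD addrA subrr sub0r normrN normrZ gtr0_norm ?divr_gt0 //.
have : t * (`|w| + 1) < e by rewrite -ltr_pdivlMr.
have : 0 <= t * `|w| by rewrite mulr_ge0 // ltW.
lra.
Unshelve. all: by end_near. Qed.

Lemma cvg_scaled_arc d w : t *: (d + (t / 2) *: w) @[t --> (0 : R)^'+] --> (0 : 'rV[R]_n).
Proof.
rewrite -[X in _ --> X](scale0r d); apply: cvgZ; last exact: cvg_arc.
by apply: cvg_at_right_filter; exact: cvg_id.
Qed.

(** The defining inequality of a directional neighbourhood is positively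
    homogeneous; for [d != 0] it is strict at [d], so it persists along arcs
    tangent to [d], and for [d = 0] both of its sides vanish. *)
Lemma arc_in_dir_nbhd (rho delta : R) d w : 0 < rho -> 0 < delta ->
  \forall t \near 0^'+, dir_nbhd rho delta d (t *: (d + (t / 2) *: w)).
Proof.
move=> rho0 delta0.
have small : \forall t \near 0^'+, enorm (t *: (d + (t / 2) *: w)) < rho.
  have H : enorm (t *: (d + (t / 2) *: w)) @[t --> (0 : R)^'+] --> enorm (0 : 'rV[R]_n).
    by apply: cvg_enorm; exact: cvg_scaled_arc.
  by rewrite enorm0 in H; exact: (cvgr_lt _ H _ rho0).
have [d0|d0] := eqVneq d 0.
  have E u : enorm (enorm d *: u - enorm u *: d) = 0.
    by rewrite d0 enorm0 scale0r scaler0 subr0 enorm0.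
  near=> t; split; first by near: t.
  by rewrite E !mulr_ge0 ?enorm_ge0 // ltW.
have nd0 : 0 < enorm d.
  by apply: lt_le_trans (norm_le_enorm d); rewrite normr_gt0.
have cd : d + (t / 2) *: w @[t --> (0 : R)^'+] --> d by exact: cvg_arc.
have nc : enorm (d + (t / 2) *: w) @[t --> (0 : R)^'+] --> enorm d.
  exact: cvg_enorm.
have gap : \forall t \near 0^'+,
    0 < delta * enorm (d + (t / 2) *: w) * enorm d
        - enorm (enorm d *: (d + (t / 2) *: w) - enorm (d + (t / 2) *: w) *: d).
  have : delta * enorm (d + (t / 2) *: w) * enorm d
        - enorm (enorm d *: (d + (t / 2) *: w) - enorm (d + (t / 2) *: w) *: d)
      @[t --> (0 : R)^'+] --> delta * enorm d * enorm d
        - enorm (enorm d *: d - enorm d *: d).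
    apply: cvgB.
      by apply: cvgM; [apply: cvgM => //; exact: cvg_cst|exact: cvg_cst].
    apply: cvg_enorm; apply: cvgB.
      by apply: cvgZ => //; exact: cvg_cst.
    by apply: cvgZ => //; exact: cvg_cst.
  rewrite subrr enorm0 subr0 => H; apply: (cvgr_gt _ H); rewrite !mulr_gt0 //.
near=> t; split; first by near: t.
have t0 : 0 < t by near: t; exact: nbhs_right_gt.
set v := d + (t / 2) *: w.
rewrite enormZ gtr0_norm //.
rewrite (_ : enorm d *: (t *: v) - _ = t *: (enorm d *: v - enorm v *: d)); last first.
  by rewrite scalerBr !scalerA (mulrC t (enorm d)).
rewrite enormZ gtr0_norm //.
rewrite (_ : delta * _ * _ = t * (delta * enorm v * enorm d)); last by ring.
rewrite ler_pM2l // -subr_ge0 ltW //.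
by rewrite /v; near: t.
Unshelve. all: by end_near. Qed.

Lemma cvg_along_arc f x d w : continuous f ->
  f (x + t *: (d + (t / 2) *: w)) @[t --> (0 : R)^'+] --> f x.
Proof.
move=> cf; apply: (@continuous_cvg _ _ _ _ _ _ f); first exact: cf.
rewrite -[X in _ --> X](addr0 x); apply: cvgD; first exact: cvg_cst.
exact: cvg_scaled_arc.
Qed.

(** If [f x < 0] this is continuity.  Otherwise [f] along the arc, divided by
    [t], is the negative slope [grad f . d] plus a term of order [t]. *)
Lemma arc_slack f x d w : twice_diff f -> f x <= 0 ->
    (f x = 0 -> dotp (grad f x) d < 0) ->
  \forall t \near 0^'+, f (x + t *: (d + (t / 2) *: w)) <= 0.
Proof.
move=> f2; rewrite le_eqVlt => /predU1P[fx0 /(_ fx0) gd|fx _]; last first.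
  have cf : continuous f by move=> y; apply: differentiable_continuous; exact: f2.1.
  have H : f (x + t *: (d + (t / 2) *: w)) @[t --> (0 : R)^'+] --> f x by exact: cvg_along_arc.
  by apply: filterS (cvgr_lt _ H _ fx) => t /ltW.
have : dotp (grad f x) d + (t / 2) * ((f (x + t *: (d + (t / 2) *: w)) - f x
      - t * dotp (grad f x) d) / (t ^+ 2 / 2)) @[t --> 0^'+]
    --> dotp (grad f x) d + 0 * (dotp (grad f x) w + quad_form (hess f x) d).
  apply: cvgD; first exact: cvg_cst.
  apply: cvgM; last exact: second_order_arc.
  rewrite -[X in _ --> X](mul0r 2^-1).
  by apply: cvgMr_tmp; apply: cvg_at_right_filter; exact: cvg_id.
rewrite mul0r addr0 => /(cvgr_lt _)/(_ 0 gd) H.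
near=> t.
have t0 : 0 < t by near: t; exact: nbhs_right_gt.
have : dotp (grad f x) d + t / 2 * ((f (x + t *: (d + (t / 2) *: w)) - f x -
      t * dotp (grad f x) d) / (t ^+ 2 / 2)) < 0 by near: t.
rewrite fx0 subr0; set y := f _ => yt.
suff : y / t < 0 by rewrite pmulr_llt0 ?invr_gt0 // => /ltW.
by apply: le_lt_trans yt; rewrite le_eqVlt; apply/orP; left; apply/eqP; field; rewrite gt_eqF.
Unshelve. all: by end_near. Qed.

End Arcs.

(** * Exact penalties on a branch and their multipliers *)

Section Penalty.
Variables (R : realType) (n m p s : nat).
Variables (f : 'rV[R]_n -> R) (g : 'rV[R]_n -> 'rV[R]_m)
          (h : 'rV[R]_n -> 'rV[R]_p).
Implicit Types (x xs d w z : 'rV[R]_n) (I : {set 'I_n}).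

Definition violation x : R :=
  \sum_(i < m) Num.max (component g i x) 0 + \sum_(i < p) `|component h i x|.

(** The subproblem on the coordinate subspace of [I] admits, in direction [d], an
    exact penalty function at [xs].  This common consequence of the two
    constraint qualifications is what the multiplier rule starts from. *)
Definition branch_penalty I xs d : Prop :=
  exists K rho delta : R, [/\ 0 <= K, 0 < rho, 0 < delta &
    forall z, dir_nbhd rho delta d z -> z \in coord_space R I ->
      f xs <= f (xs + z) + K * violation (xs + z)].

Lemma violation_ge0 x : 0 <= violation x.
Proof.
by rewrite addr_ge0 //; apply: sumr_ge0 => i _; rewrite ?normr_ge0 // le_max lexx orbT.
Qed.

Lemma edist_to_le (A : set 'rV[R]_n) x y : A y -> edist_to A x <= enorm (x - y).
Proof.
move=> Ay; apply: ge_inf; last by exists y.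
by exists 0 => _ [z _ <-]; exact: enorm_ge0.
Qed.

Lemma edist_to_approx (A : set 'rV[R]_n) x y (e : R) : A y -> 0 < e ->
  exists2 z, A z & enorm (x - z) < edist_to A x + e.
Proof.
move=> Ay e0; have hi : has_inf [set enorm (x - z) | z in A].
  split; first by exists (enorm (x - y)), y.
  by exists 0 => _ [z _ <-]; exact: enorm_ge0.
by have [_ [z Az <-] ze] := inf_adherent e0 hi; exists z.
Qed.

(** Moving from [x] to a nearly closest feasible point, at which local optimality
    applies, changes [f] by at most the Lipschitz constant times the distance.
    The constraint qualification bounds this distance by the violation, since on
    a branch the distance to the sparse set vanishes. *)
Lemma MSCQ_branch_penalty I xs d : C2 f -> local_minimizer s f g h xs ->
    MSCQ s g h xs d -> supp xs \subset I -> #|I| = s -> branch_penalty I xs d.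
Proof.
move=> [df dgf _] [Fxs /nbhs_normP[r1 /= r10 r1P]].
move=> [alpha [rho [delta [alpha0 rho0 delta0 H]]]] sI cI.
have cg : {for xs, continuous (grad f)} by apply: differentiable_continuous.
have [r2 r20 [L L0 LP]] := loc_lipschitz df cg.
pose r := Num.min r1 r2.
have r0 : 0 < r by rewrite lt_min r10 r20.
(* r / 3: the nearly closest feasible point is within |z|, plus |z|, plus the
   tolerance r / 3, of [xs] *)
exists (L * alpha), (Num.min rho (r / 3)), delta; split => //.
- by rewrite mulr_ge0 // ltW.
- by rewrite lt_min rho0 divr_gt0.
move=> z [zr zd] zI; move: zr; rewrite lt_min => /andP[zrho zr].
have znorm : `|z| < r / 3 by apply: le_lt_trans zr; exact: norm_le_enorm.
set x := xs + z.
have xE : x - xs = z by rewrite /x addrC addKr.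
have Dz : edist_to (feasible_set s g h) x <= enorm z.
  by rewrite -xE; exact: edist_to_le.
have Dalpha := H z (conj zrho zd).
have S0 : edist_to (@sparse_set R n s) x <= 0.
  have Sx : sparse_set s x.
    exists I => //; rewrite /x rpredD // coord_space_supp //.
  by have := edist_to_le x Sx; rewrite subrr enorm0.
have {S0} Dalpha : edist_to (feasible_set s g h) x <= alpha * violation x.
  apply: le_trans Dalpha _; rewrite ler_wpM2l // -/x; move: S0.
  by rewrite /violation; lra.
have main : f xs <= f x + L * edist_to (feasible_set s g h) x.
  apply/ler_addgt0Pr => e e0.
  have e1 : 0 < Num.min (e / L) (r / 3) by rewrite lt_min !divr_gt0.
  have [y Fy] := edist_to_approx x Fxs e1.
  set D := edist_to _ _ in Dz Dalpha *; set eps := Num.min _ _ in e1 * => yD.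
  have epsr : eps <= r / 3 by rewrite ge_min lexx orbT.
  have epse : L * eps <= e.
    by rewrite mulrC -ler_pdivlMr // ge_min lexx.
  have xy : `|y - x| < D + eps.
    by rewrite distrC; apply: le_lt_trans yD; exact: norm_le_enorm.
  have yr : `|y - xs| < r.
    have -> : y - xs = (y - x) + z by rewrite -xE addrA subrK.
    by apply: le_lt_trans (ler_normD _ _) _; lra.
  have xr : `|x - xs| < r2.
    rewrite xE; apply: (@lt_le_trans _ _ r).
      by lra.
    by rewrite ge_min lexx orbT.
  have yr2 : `|y - xs| < r2 by apply: lt_le_trans yr _; rewrite ge_min lexx orbT.
  have yr1 : `|xs - y| < r1.
    by rewrite distrC; apply: lt_le_trans yr _; rewrite ge_min lexx.
  have f1 := r1P y yr1 Fy.
  have f2 := LP x y xr yr2.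
  have f3 := ler_norm (f y - f x).
  have f4 : L * `|y - x| <= L * (D + eps) by rewrite ler_wpM2l // ltW.
  lra.
apply: le_trans main _; rewrite lerD2l -mulrA ler_wpM2l // ltW //.
Qed.

Lemma lagrangian_expand (lg : 'rV[R]_m) (lh : 'rV[R]_p) :
    C2 f -> C2_map g -> C2_map h ->
  [/\ twice_diff (lagrangian f g h lg lh),
      forall x, grad (lagrangian f g h lg lh) x = grad f x
        + \sum_(i < m) lg 0 i *: grad (component g i) x
        + \sum_(i < p) lh 0 i *: grad (component h i) x
    & forall x d, quad_form (hess (lagrangian f g h lg lh) x) d =
        quad_form (hess f x) d
        + \sum_(i < m) lg 0 i * quad_form (hess (component g i) x) d
        + \sum_(i < p) lh 0 i * quad_form (hess (component h i) x) d].
Proof.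
move=> f2 g2 h2.
have tf : twice_diff f by case: f2.
have tg i : twice_diff (component g i) by case: (g2 i).
have th i : twice_diff (component h i) by case: (h2 i).
have [t1 g1 h1] := twice_diff_sum (lg 0) (index_enum _) tf tg.
have [t3 g3 h3] := twice_diff_sum (lh 0) (index_enum _) t1 th.
split=> [|x|x d]; first exact: t3.
  exact: etrans (g3 x) (congr1 (fun y => y + _) (g1 x)).
exact: etrans (h3 x d) (congr1 (fun y => y + _) (h1 x d)).
Qed.

(** Passing to the limit in the penalized inequality along arcs
    [xs + t d + t^2/2 w]: the first-order terms drop out because [d] is critical
    and the second-order ones form a piecewise linear function of [w]. *)
Lemma penalty_second_order I xs d w : C2 f -> C2_map g -> C2_map h ->
    (forall i, component g i xs <= 0) -> (forall i, component h i xs = 0) ->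
    critical_cone s f g h xs d -> d \in coord_space R I -> w \in coord_space R I ->
  forall K rho delta : R, 0 <= K -> 0 < rho -> 0 < delta ->
    (forall z, dir_nbhd rho delta d z -> z \in coord_space R I ->
      f xs <= f (xs + z) + K * violation (xs + z)) ->
  0 <= dotp (grad f xs) w + quad_form (hess f xs) d
    + K * (\sum_(i in active_dir g xs d)
             Num.max (dotp (grad (component g i) xs) w
                      + quad_form (hess (component g i) xs) d) 0
           + \sum_(i < p) `|dotp (grad (component h i) xs) w
                            + quad_form (hess (component h i) xs) d|).
Proof.
move=> f2 g2 h2 gx hx [dg dh _ df] dI wI K rho delta K0 rho0 delta0 H.
have tf : twice_diff f by case: f2.
have tg i : twice_diff (component g i) by case: (g2 i).
have th i : twice_diff (component h i) by case: (h2 i).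
(* for h and the constraints active along d, Q is the value divided by t^2/2 *)
pose Q (F : 'rV[R]_n -> R) (t : R) :=
  (F (xs + t *: (d + (t / 2) *: w)) - F xs - t * dotp (grad F xs) d) / (t ^+ 2 / 2).
have cQ F : twice_diff F ->
    Q F t @[t --> (0 : R)^'+] --> dotp (grad F xs) w + quad_form (hess F xs) d.
  by move=> F2; exact: second_order_arc.
have lim : Q f t + K * (\sum_(i in active_dir g xs d) Num.max (Q (component g i) t) 0
      + \sum_(i < p) `|Q (component h i) t|) @[t --> (0 : R)^'+] -->
    dotp (grad f xs) w + quad_form (hess f xs) d
    + K * (\sum_(i in active_dir g xs d)
             Num.max (dotp (grad (component g i) xs) w
                      + quad_form (hess (component g i) xs) d) 0
           + \sum_(i < p) `|dotp (grad (component h i) xs) w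
                            + quad_form (hess (component h i) xs) d|).
  apply: cvgD; first exact: cQ.
  apply: cvgM; first exact: cvg_cst.
  apply: cvgD; apply: cvg_sumr => i _.
    by apply: cvg_max0; exact: cQ.
  by apply: cvg_norm; exact: cQ.
apply: (cvgr_to_ge lim).
have slack : \forall t \near (0 : R)^'+, forall i, i \notin active_dir g xs d ->
    component g i (xs + t *: (d + (t / 2) *: w)) <= 0.
  apply: filter_forall => i; have [iA|iA] := boolP (i \in active_dir g xs d).
    by near=> t.
  near=> t => _; near: t; apply: arc_slack => // gi0.
  have iact : i \in active g xs by rewrite inE gi0 eqxx.
  rewrite lt_neqAle dg // andbT; move: iA; rewrite inE iact /=; exact.
near=> t.
have t0 : 0 < t by near: t; exact: nbhs_right_gt.
have t2 : 0 < t ^+ 2 / 2 by rewrite divr_gt0 // exprn_gt0.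
have zV : dir_nbhd rho delta d (t *: (d + (t / 2) *: w)).
  by near: t; exact: arc_in_dir_nbhd.
have sl : forall i, i \notin active_dir g xs d ->
    component g i (xs + t *: (d + (t / 2) *: w)) <= 0 by near: t.
have zI : t *: (d + (t / 2) *: w) \in coord_space R I.
  by rewrite rpredZ // rpredD // rpredZ.
have := H _ zV zI; rewrite /violation (bigID (mem (active_dir g xs d))) /=.
rewrite [X in _ + X + _]big1 => [|i iA]; last by rewrite max_r // sl.
rewrite addr0.
have -> : \sum_(i in active_dir g xs d) Num.max
      (component g i (xs + t *: (d + (t / 2) *: w))) 0 =
    (t ^+ 2 / 2) * \sum_(i in active_dir g xs d) Num.max (Q (component g i) t) 0.
  rewrite mulr_sumr; apply: eq_bigr => i.
  rewrite inE => /andP[]; rewrite inE => /eqP gi /eqP di.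
  rewrite /Q gi di mulr0 !subr0 maxr_pMr ?(ltW t2) // mulr0 (mulrC (t ^+ 2 / 2)) divfK //.
  by rewrite gt_eqF.
have -> : \sum_(i < p) `|component h i (xs + t *: (d + (t / 2) *: w))| =
    (t ^+ 2 / 2) * \sum_(i < p) `|Q (component h i) t|.
  rewrite mulr_sumr; apply: eq_bigr => i _.
  rewrite /Q hx dh mulr0 !subr0 normrM [`|(_ / _)^-1|]gtr0_norm ?invr_gt0 //.
  by rewrite (mulrC (t ^+ 2 / 2)) divfK // gt_eqF.
set SG := \sum_(i in _) _; set SH := \sum_(i < p) _.
have Ef : f (xs + t *: (d + (t / 2) *: w)) =
    f xs + t * dotp (grad f xs) d + (t ^+ 2 / 2) * Q f t.
  by rewrite /Q (mulrC (t ^+ 2 / 2)) divfK ?gt_eqF //; ring.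
rewrite Ef => Hf; rewrite -(pmulr_rge0 _ t2).
have : t * dotp (grad f xs) d <= 0 by rewrite mulr_ge0_le0 // ltW.
lra.
Unshelve. all: by end_near. Qed.

(** In the affine function produced by duality, the linear part is the gradient of
    the Lagrangian and the constant part its second derivative along [d]; [eta]
    absorbs the components of the gradient outside the branch. *)
Lemma penalty_multiplier I xs d : C2 f -> C2_map g -> C2_map h ->
    feasible_set s g h xs -> critical_cone s f g h xs d ->
    d \in coord_space R I -> branch_penalty I xs d ->
  exists lg lh eta, [/\ is_multiplier f g h xs d lg lh eta,
    forall i, i \in I -> eta 0 i = 0
    & 0 <= quad_form (hess (lagrangian f g h lg lh) xs) d].
Proof.
move=> f2 g2 h2 [gx hx _] dC dI [K [rho [delta [K0 rho0 delta0 H]]]].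
have [l [mu [l0 stat soc]]] := branch_duality K0 (fun w wI =>
  penalty_second_order f2 g2 h2 gx hx dC dI wI K0 rho0 delta0 H).
pose lg : 'rV[R]_m := \row_i (if i \in active_dir g xs d then l i else 0).
pose lh : 'rV[R]_p := \row_i mu i.
pose eta := - (grad f xs + \sum_(i in active_dir g xs d) lg 0 i *: grad (component g i) xs
      + \sum_(i < p) lh 0 i *: grad (component h i) xs).
have sg (V : lmodType R) (F : 'I_m -> V) :
    \sum_(i in active_dir g xs d) lg 0 i *: F i =
    \sum_(i in active_dir g xs d) l i *: F i.
  by apply: eq_bigr => i iA; rewrite mxE iA.
have shh (V : lmodType R) (F : 'I_p -> V) :
    \sum_i lh 0 i *: F i = \sum_i mu i *: F i.
  by apply: eq_bigr => i iA; rewrite mxE.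
exists lg, lh, eta; split.
- split=> [i iA|i /negbTE iA|]; first by rewrite mxE iA.
    by rewrite mxE iA.
  by rewrite /eta subrr.
- move=> i iI; rewrite /eta sg shh mxE; apply/eqP; rewrite oppr_eq0; apply/eqP.
  exact: stat.
have [_ _ ->] := lagrangian_expand lg lh f2 g2 h2.
rewrite (bigID (mem (active_dir g xs d))) /= [X in _ + (_ + X) + _]big1 => [|i iA].
  by rewrite addr0 (sg R^o) (shh R^o).
by rewrite mxE (negbTE iA) mul0r.
Qed.

End Penalty.

(** * Solving independent equations near a point *)

Section DualBasis.
Variables (R : realType) (n : nat).

(** The dual vectors are the columns of a right inverse of the matrix whose rows
    are the given free family. *)
Lemma free_dual (T : eqType) (r : seq T) (F : T -> 'rV[R]_n) :
    uniq r -> free (map F r) ->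
  exists b : T -> 'rV[R]_n, forall i j, i \in r -> j \in r ->
    dotp (F i) (b j) = (i == j)%:R.
Proof.
move=> ur fr.
pose X := map_tuple F (in_tuple r).
pose A := \matrix_(k < size r) tnth X k.
have rf : row_free A.
  apply: inj_row_free => v vA; apply/rowP => k; rewrite mxE.
  have /freeP fX : free X by [].
  apply: (fX (fun k => v 0 k)); rewrite -[RHS]vA mulmx_sum_row.
  by apply: eq_bigr => i _; rewrite rowK (tnth_nth 0).
pose B := pinvmx A.
have AB : A *m B = 1%:M := mulmxVp rf.
exists (fun j => if insub (index j r) is Some k then (col k B)^T else 0).
move=> i j ir jr; have si := ir; have sj := jr.
rewrite -index_mem in si; rewrite -index_mem in sj; rewrite insubT.
pose ki := Ordinal si; pose kj := Ordinal sj.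
have -> : F i = row ki A.
  by rewrite rowK tnth_map (tnth_nth i) /= nth_index.
have := congr1 (fun M : 'M_(size r) => M ki kj) AB.
rewrite !mxE => ABij; rewrite -[RHS](_ : (ki == kj)%:R = _); last first.
  congr (_%:R); congr nat_of_bool; apply/eqP/eqP => [/(congr1 val) /= E|E].
    by rewrite -(nth_index i ir) E nth_index.
  by apply: val_inj; rewrite /= E.
by rewrite -ABij; apply: eq_bigr => l _; rewrite !mxE.
Qed.

End DualBasis.

Section LocalSolve.
Variables (R : realType) (n : nat).

Lemma norm_row_le N (u : 'rV[R]_N) (e : R) : 0 <= e ->
  (forall i, `|u 0 i| <= e) -> `|u| <= e.
Proof.
move=> e0 H; rewrite [leLHS]/Num.norm /= mx_normrE.
by apply/bigmax_leP; split => // -[i0 i] _ /=; rewrite (ord1 i0).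
Qed.

Lemma continuous_row (T : topologicalType) N (F : 'I_N -> T -> R) :
  (forall i, continuous (F i)) -> continuous (fun y => \row_i F i y : 'rV[R]_N).
Proof.
move=> cF y; apply/cvgrPdist_le => e e0.
have : \forall t \near y, forall i, `|F i y - F i t| <= e.
  apply: filter_forall => i; have /cvgrPdist_le := cF i y; exact.
apply: filterS => t H; apply: norm_row_le; first exact: ltW.
by move=> i; rewrite !mxE; exact: H.
Qed.

Lemma compact_closed_ball N (M : R) : compact [set y : 'rV[R]_N | `|y| <= M].
Proof.
apply: bounded_closed_compact.
  exists M; split; first exact: num_real.
  by move=> M' MM' y /= yM; apply: le_trans yM _; exact: ltW.
apply: (@preimage_closed _ _ (fun y : 'rV[R]_N => `|y|) [set x : R | x <= M]).
  by move=> y _; exact: norm_continuous.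
exact: closed_le.
Qed.

Lemma continuous_displacement (V : normedModType R) (Phi : V -> V) :
  continuous Phi -> continuous (fun y => `|Phi y - y|).
Proof.
move=> cPhi y; apply: cvg_norm; apply: cvgB; [exact: cPhi|exact: cvg_id].
Qed.

Lemma continuous_combination (V : normedModType R) (T : topologicalType)
    (I : finType) (a : I -> T -> R) (b : I -> V) :
  (forall i, continuous (a i)) -> continuous (fun y => \sum_i a i y *: b i).
Proof.
move=> ca; apply: continuous_big; first exact: add_continuous.
by move=> i _ y; apply: cvgZ; [exact: ca|exact: cvg_cst].
Qed.

Lemma continuous_shifted (V W : normedModType R) (T : topologicalType)
    (F : V -> W) (B : T -> V) x : continuous F -> continuous B ->
  continuous (fun y => F (x + B y)).
Proof.
move=> cF cB y; apply: (@continuous_cvg _ _ _ _ _ _ F); first exact: cF.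
by apply: cvgD; [exact: cvg_cst|exact: cB].
Qed.

Lemma continuous_newton_step (T : topologicalType) (a v : T -> R) (c c' : R) :
  continuous a -> continuous v -> continuous (fun y => a y - (v y - c - c')).
Proof.
move=> ca cv y; apply: cvgB; first exact: ca.
apply: cvgB; last exact: cvg_cst.
by apply: cvgB; [exact: cv|exact: cvg_cst].
Qed.

(** A contraction of a closed ball has a fixed point because the displacement
    attains its minimum, which must be zero. *)
Lemma ball_fixed_point N (Phi : 'rV[R]_N -> 'rV[R]_N) (M : R) : 0 <= M ->
    continuous Phi ->
    (forall y, `|y| <= M -> `|Phi y| <= M) ->
    (forall y y', `|y| <= M -> `|y'| <= M ->
       `|Phi y - Phi y'| <= 2^-1 * `|y - y'|) ->
  exists2 y, `|y| <= M & Phi y = y.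
Proof.
move=> M0 cPhi stab contr.
have cF := continuous_displacement cPhi.
have D0 : [set y : 'rV[R]_N | `|y| <= M] !=set0 by exists 0; rewrite /= normr0.
have [y yM ymin] := EVT_min_rV D0 (@compact_closed_ball N M)
  (continuous_subspaceT cF).
rewrite inE /= in yM; exists y => //.
have := ymin (Phi y); rewrite inE /= => /(_ (stab _ yM)) H1.
have H2 := contr _ _ (stab _ yM) yM.
by apply/eqP; rewrite -subr_eq0 -normr_le0; lra.
Qed.

(** Let [B y] be the combination of the [b k] with coefficients [y].  As the [b k]
    are dual to the gradients, the derivative of [y |-> G (x + B y)] is close to
    the identity near [xs], so [y |-> y - (G (x + B y) - G x - c)] is a
    contraction of the ball of radius [2 e]; its fixed point solves the
    equations. *)
Lemma local_solve N (G : 'I_N -> 'rV[R]_n -> R) (xs : 'rV[R]_n)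
    (b : 'I_N -> 'rV[R]_n) :
    (forall k y, differentiable (G k) y) ->
    (forall k, {for xs, continuous (grad (G k))}) ->
    (forall k l, dotp (grad (G k) xs) (b l) = (k == l)%:R) ->
  exists r C : R, [/\ 0 < r, 0 < C & forall x (c : 'I_N -> R) e,
    `|x - xs| < r -> e < r -> 0 <= e -> (forall k, `|c k| <= e) ->
    exists y : 'I_N -> R, let u := \sum_k y k *: b k in
      `|u| <= C * e /\ forall k, G k (x + u) = G k x + c k].
Proof.
move=> dG cG Gb.
pose M := \sum_k `|b k| + 1.
have M0 : 0 < M by apply: ltr_wpDl => //; exact: sumr_ge0.
pose B (y : 'rV[R]_N) := \sum_k y 0 k *: b k.
have BB y y' : B y - B y' = B (y - y').
  by rewrite /B -sumrB; apply: eq_bigr => k _; rewrite !mxE scalerBl.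
have Bn y : `|B y| <= M * `|y|.
  apply: le_trans (ler_norm_sum _ _ _) _.
  have : \sum_k `|b k| * `|y| <= M * `|y|.
    by rewrite -mulr_suml ler_wpM2r // /M lerDl.
  apply: le_trans; apply: ler_sum => k _.
  by rewrite normrZ mulrC ler_wpM2l // norm_coord_le.
have GB k y : dotp (grad (G k) xs) (B y) = y 0 k.
  rewrite dotp_sumr (bigD1 k) //= big1 => [|l lk]; rewrite dotpZr Gb.
    by rewrite eqxx mulr1 addr0.
  by rewrite eq_sym (negbTE lk) mulr0.
have e1 : 0 < (2 * M)^-1 by rewrite invr_gt0 mulr_gt0.
have near_r : \forall r \near (0 : R)^'+, forall k y z,
    `|y - xs| < r -> `|y + z - xs| < r ->
    `|G k (y + z) - G k y - dotp (grad (G k) xs) z| <= (2 * M)^-1 * `|z|.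
  apply: filter_forall => k.
  have [rk rk0 rkP] := strict_diff (dG k) (cG k) e1.
  near=> r => y z yr zr.
  have rrk : r < rk by near: r; exact: nbhs_right_lt.
  by apply: rkP; [apply: lt_trans yr rrk|apply: lt_trans zr rrk].
have [r [r0 rP]] := filter_ex (filterI (nbhs_right_gt (0 : R)) near_r).
(* small enough that x + B y stays within r of [xs] when |x - xs| < r1 and
   |y| <= 2 e < 2 r1 *)
pose r1 := r / (1 + 2 * M).
have D0 : 0 < 1 + 2 * M by rewrite addr_gt0 // mulr_gt0.
have r10 : 0 < r1 by rewrite divr_gt0.
exists r1, (2 * M); split=> //; first by rewrite mulr_gt0.
move=> x c e xr er e0 ce.
have close y : `|y| <= 2 * e -> `|x + B y - xs| < r.
  move=> ye; rewrite addrAC; apply: le_lt_trans (ler_normD _ _) _.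
  have H1 : M * `|y| <= M * (2 * r1).
    by rewrite ler_pM2l //; lra.
  have H2 : r1 * (1 + 2 * M) = r by rewrite /r1 divfK // gt_eqF.
  by have := Bn y; lra.
pose Phi (y : 'rV[R]_N) := \row_k (y 0 k - (G k (x + B y) - G k x - c k)).
have contr y y' : `|y| <= 2 * e -> `|y'| <= 2 * e ->
    `|Phi y - Phi y'| <= 2^-1 * `|y - y'|.
  move=> ye ye'; apply: norm_row_le; first by rewrite mulr_ge0 ?invr_ge0.
  move=> k; rewrite !mxE.
  have Ex : x + B y' + B (y - y') = x + B y by rewrite -BB -addrA (addrC (B y')) subrK.
  have := rP k (x + B y') (B (y - y')) (close _ ye').
  rewrite Ex GB !mxE => /(_ (close _ ye)) H.
  have -> : y 0 k - (G k (x + B y) - G k x - c k)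
      - (y' 0 k - (G k (x + B y') - G k x - c k)) =
      - (G k (x + B y) - G k (x + B y') - (y 0 k - y' 0 k)) by ring.
  rewrite normrN; apply: le_trans H _.
  have -> : 2^-1 * `|y - y'| = (2 * M)^-1 * (M * `|y - y'|).
    by field; rewrite gt_eqF.
  by rewrite ler_wpM2l // ltW.
have Phi0 : `|Phi 0| <= e.
  apply: norm_row_le => // k; rewrite !mxE.
  have -> : B 0 = 0 by rewrite /B big1 // => l _; rewrite mxE scale0r.
  by rewrite addr0 subrr !sub0r opprK.
have e2 : 0 <= 2 * e by rewrite mulr_ge0.
have stab y : `|y| <= 2 * e -> `|Phi y| <= 2 * e.
  move=> ye; have := contr y 0 ye; rewrite normr0 subr0 => /(_ e2) H.
  by have := ler_normD (Phi y - Phi 0) (Phi 0); rewrite subrK; lra.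
have cy k : continuous (fun y : 'rV[R]_N => y 0 k) by exact: coord_continuous.
have cB : continuous B by exact: continuous_combination b cy.
have cPhi : continuous Phi.
  apply: continuous_row => k.
  have cGk : continuous (G k) by move=> y; exact: differentiable_continuous.
  have cGB := continuous_shifted (x := x) cGk cB.
  exact: continuous_newton_step (cy k) cGB.
have [y ye yP] := ball_fixed_point e2 cPhi stab contr.
exists (y 0); rewrite -/(B y) /=; split.
  have : M * `|y| <= M * (2 * e) by rewrite ler_pM2l.
  by have := Bn y; lra.
move=> k; have := congr1 (fun v : 'rV_N => v 0 k) yP; rewrite mxE.
lra.
Unshelve. all: by end_near. Qed.

End LocalSolve.

(** * Consequences of CCOP-LICQ *)

Lemma set_extension (T : finType) (J : {set T}) (s : nat) :
  (#|J| <= s <= #|T|)%N -> exists2 I : {set T}, J \subset I & #|I| = s.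
Proof.
move=> /andP[/subnKC <-]; elim: (s - #|J|)%N => [|k IH] le.
  by exists J; rewrite ?addn0.
have [|I JI cI] := IH; first by apply: leq_trans le; rewrite leq_add2l.
have [i iI] : exists i, i \notin I.
  apply/existsP; rewrite -negb_forall; apply/negP => /forallP allI.
  move: le; rewrite addnS -cI ltnNge => /negP; apply; apply: subset_leq_card.
  by apply/fintype.subsetP => i _; apply: allI.
exists (i |: I); first exact: fintype.subset_trans JI (subsetU1 _ _).
by rewrite cardsU1 iI cI addnS.
Qed.

Section LICQ.
Variables (R : realType) (n m p s : nat).
Variables (f : 'rV[R]_n -> R) (g : 'rV[R]_n -> 'rV[R]_m)
          (h : 'rV[R]_n -> 'rV[R]_p).
Implicit Types (x xs d w z : 'rV[R]_n) (I : {set 'I_n}).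

Definition constraint (k : 'I_m + 'I_p) : 'rV[R]_n -> R :=
  match k with inl i => component g i | inr j => component h j end.

(** The vectors whose independence CCOP-LICQ asserts, indexed by a sum type so
    that dual vectors can be addressed by the constraint they belong to. *)
Definition licq_vector xs (k : ('I_m + 'I_p) + 'I_n) : 'rV[R]_n :=
  match k with
  | inl c => grad (constraint c) xs
  | inr i => basis_vec R i
  end.

Definition licq_index xs d : pred (('I_m + 'I_p) + 'I_n) := fun k =>
  match k with
  | inl (inl i) => i \in active g xs
  | inl (inr _) => true
  | inr i => i \in (zeros xs :&: zeros d)%SET
  end.

Lemma LICQ_dual xs d : CCOP_LICQ g h xs d ->
  exists b : ('I_m + 'I_p) + 'I_n -> 'rV[R]_n, forall k l,
    licq_index xs d k -> licq_index xs d l ->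
    dotp (licq_vector xs k) (b l) = (k == l)%:R.
Proof.
move=> fr.
pose r : seq (('I_m + 'I_p) + 'I_n) := [seq inl (inl i) | i <- enum (active g xs)]
  ++ [seq inl (inr j) | j <- enum 'I_p]
  ++ [seq inr i | i <- enum (zeros xs :&: zeros d)%SET].
have memr k : (k \in r) = licq_index xs d k.
  rewrite !mem_cat; apply/idP/idP.
    by case/or3P => /mapP[i + ->] /=; rewrite mem_enum.
  case: k => [[i|j]|i] /= H; apply/or3P.
  - by apply: Or31; rewrite map_f // mem_enum.
  - by apply: Or32; rewrite map_f // mem_enum.
  - by apply: Or33; rewrite map_f // mem_enum.
have ur : uniq r.
  rewrite !cat_uniq.
  rewrite map_inj_uniq ?enum_uniq => [|i j []//].
  rewrite map_inj_uniq ?enum_uniq => [|i j []//].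
  rewrite map_inj_uniq ?enum_uniq => [|i j []//].
  rewrite !andTb andbT; apply/andP; split; apply/hasPn => k.
    rewrite mem_cat => /orP[] /mapP[j _ ->]; by apply/negP => /mapP[].
  by move=> /mapP[j _ ->]; apply/negP => /mapP[].
have frr : free (map (licq_vector xs) r).
  rewrite /r !map_cat -[X in free X](_ : [seq grad (component g i) xs | i <- enum (active g xs)]
      ++ [seq grad (component h i) xs | i <- enum 'I_p]
      ++ [seq basis_vec R i | i <- enum (zeros xs :&: zeros d)%SET] = _) //.
  congr (_ ++ (_ ++ _)).
  - exact: (map_comp (licq_vector xs) (fun i => inl (inl i))).
  - exact: (map_comp (licq_vector xs) (fun j => inl (inr j))).
  - exact: (map_comp (licq_vector xs) inr).
have [b bP] := free_dual ur frr.
by exists b => k l kP lP; apply: bP; rewrite memr.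
Qed.

Lemma continuous_violation (T : topologicalType) (A B : finType)
    (u : A -> T -> R) (v : B -> T -> R) :
  (forall i, continuous (u i)) -> (forall j, continuous (v j)) ->
  continuous (fun y => \sum_i Num.max (u i y) 0 + \sum_j `|v j y|).
Proof.
move=> cu cv y; apply: cvgD; apply: cvg_sumr => i _.
  by apply: cvg_max0; exact: cu.
by apply: cvg_norm; exact: cv.
Qed.

Lemma near_inactive (T : topologicalType) (A : finType) (u : A -> T -> R)
    (P : pred A) (y0 : T) :
    (forall i, continuous (u i)) -> (forall i, ~~ P i -> u i y0 < 0) ->
  \forall y \near y0, forall i, ~~ P i -> u i y <= 0.
Proof.
move=> cu u0; apply: filter_forall => i; have [Pi|/u0 ui] := boolP (P i).
  by near=> y.
by apply: filterS (cvgr_lt _ (cu i y0) _ ui) => y /ltW.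
Unshelve. all: by end_near. Qed.

Lemma near_lt (T : topologicalType) (u : T -> R) (y : T) (c : R) :
  continuous u -> u y < c -> \forall z \near y, u z < c.
Proof. by move=> cu uc; exact: (cvgr_lt _ (cu y) _ uc). Qed.

Lemma notin_supp xs d i : i \notin (supp xs :|: supp d)%SET =
  (i \in (zeros xs :&: zeros d)%SET).
Proof. by rewrite !inE negb_or !negbK. Qed.

(** A point of the branch near [xs] is made feasible by a displacement
    proportional to its violation: active inequalities are corrected to
    [min (g_i x) 0] and equalities to [0], along dual vectors.  These are also
    dual to the [e_j] with [j] outside [supp xs :|: supp d], hence vanish at such
    [j], and the correction stays in the branch. *)
Lemma LICQ_branch_penalty I xs d : C2 f -> C2_map g -> C2_map h ->
    local_minimizer s f g h xs -> CCOP_LICQ g h xs d ->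
    (supp xs :|: supp d)%SET \subset I -> #|I| = s -> branch_penalty f g h I xs d.
Proof.
move=> [df dgf _] g2 h2 [Fxs mins] licq JI cI.
have [gx hx _] := Fxs.
have tg i : twice_diff (component g i) by case: (g2 i).
have th i : twice_diff (component h i) by case: (h2 i).
have cgc i : continuous (component g i).
  by move=> y; apply: differentiable_continuous; exact: (tg i).1.
have chc i : continuous (component h i).
  by move=> y; apply: differentiable_continuous; exact: (th i).1.
have tc k : twice_diff (constraint k) by case: k.
have [b bP] := LICQ_dual licq.
pose A : {set 'I_m + 'I_p} :=
  [set k | if k is inl i then i \in active g xs else true]%SET.
have idxA k : k \in A -> licq_index xs d (inl k) by rewrite inE; case: k.
pose G (i : 'I_#|A|) := constraint (enum_val i).
pose bb (i : 'I_#|A|) := b (inl (enum_val i)).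
have [| | |r0 [C [r00 C0 solve]]] := @local_solve R n _ G xs bb.
- by move=> k y; exact: (tc _).1.
- by move=> k; apply: differentiable_continuous; exact: (tc _).2.
- move=> k l; rewrite (bP (inl (enum_val k)) (inl (enum_val l))).
  + by congr (_%:R); congr nat_of_bool; rewrite (inj_eq inl_inj) (inj_eq enum_val_inj).
  + exact/idxA/enum_valP.
  + exact/idxA/enum_valP.
have cgf : {for xs, continuous (grad f)} by apply: differentiable_continuous.
have [r2 r20 [L L0 LP]] := loc_lipschitz df cgf.
have inact : \forall y \near xs, forall i, i \notin active g xs -> component g i y <= 0.
  apply: near_inactive => // i iA.
  by rewrite lt_neqAle gx andbT; move: iA; rewrite inE.
have /nbhs_normP[r1 /= r10 r1P] := mins.
have /nbhs_normP[r3 /= r30 r3P] := inact.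
pose r := Num.min (Num.min r1 r3) r2.
have rpos : 0 < r by rewrite !lt_min r10 r30.
pose e1 := Num.min r0 (r / (2 * C)).
have e10 : 0 < e1 by rewrite lt_min r00 divr_gt0 // mulr_gt0.
have viol0 : violation g h xs = 0.
  rewrite /violation !big1 ?addr0 // => i _; first by rewrite hx normr0.
  by rewrite max_r.
have cviol : continuous (violation g h) := continuous_violation cgc chc.
have viole : violation g h xs < e1 by rewrite viol0.
have /nbhs_normP[r4 /= r40 r4P] := near_lt cviol viole.
pose rho := Num.min (Num.min r0 r4) (r / 2).
have rho0 : 0 < rho by rewrite !lt_min r00 r40 divr_gt0.
exists (L * C), rho, 1; split => //; first by rewrite mulr_ge0 // ltW.
move=> z [zr _] zI; set x := xs + z.
have xE : x - xs = z by rewrite /x addrC addKr.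
have : `|z| < rho by apply: le_lt_trans zr; exact: norm_le_enorm.
rewrite !lt_min => /andP[/andP[zr0 zr4] zr2].
set e := violation g h x.
have : e < e1 by apply: r4P; rewrite /= distrC xE.
rewrite lt_min => /andP[er0 er].
pose c (i : 'I_#|A|) := match enum_val i with
  | inl i => - Num.max (component g i x) 0
  | inr j => - component h j x end.
have ge0 i : 0 <= Num.max (component g i x) 0 by rewrite le_max lexx orbT.
have ce k : `|c k| <= e.
  rewrite /c /e /violation; case: (enum_val k) => i; rewrite normrN.
    rewrite (ger0_norm (ge0 i)) (bigD1 i) //= -addrA lerDl addr_ge0 //.
      by apply: sumr_ge0 => j _.
    exact: sumr_ge0.
  rewrite [X in _ + X](bigD1 i) //= addrCA lerDl addr_ge0 //.
    by apply: sumr_ge0 => j _.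
  exact: sumr_ge0.
have xr0 : `|x - xs| < r0 by rewrite xE.
have [y [uC uG]] := solve x c e xr0 er0 (violation_ge0 _ _ _) ce.
set u := \sum_k y k *: bb k in uC uG.
have uI : u \in coord_space R I.
  apply: rpred_sum => k _; apply: rpredZ; apply/coord_spaceP => i iI.
  have iJ : i \in (zeros xs :&: zeros d)%SET.
    by rewrite -notin_supp; apply: contra iI => /(fintype.subsetP JI).
  have := bP (inr i) (inl (enum_val k)) iJ (idxA _ (enum_valP k)).
  by rewrite /= dotpC dotp_basis.
have unorm : `|u| < r / 2.
  apply: le_lt_trans uC _.
  have : C * e < C * (r / (2 * C)) by rewrite ltr_pM2l.
  by rewrite (_ : C * (r / (2 * C)) = r / 2) //; field; rewrite gt_eqF.
have xur : `|x + u - xs| < r.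
  rewrite addrAC xE; apply: le_lt_trans (ler_normD _ _) _; lra.
move: (xur); rewrite distrC !lt_min => /andP[/andP[/r1P minxu /r3P inactxu] _].
have xsI : xs \in coord_space R I.
  by rewrite coord_space_supp; apply: fintype.subset_trans JI; exact: finset.subsetUl.
have Fxu : feasible_set s g h (x + u).
  split=> [i|j|].
  - have [iA|/inactxu //] := boolP (i \in active g xs).
    have kA : inl i \in A by rewrite inE.
    have := uG (enum_rank_in kA (inl i)).
    by rewrite /G /c enum_rankK_in //= => ->; rewrite subr_le0 le_max lexx.
  - have kA : inr j \in A by rewrite inE.
    have := uG (enum_rank_in kA (inr j)).
    by rewrite /G /c enum_rankK_in //= => ->; rewrite subrr.
  - rewrite -cI; apply: subset_leq_card; rewrite -coord_space_supp.
    by rewrite !rpredD.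
have xr2 : `|x - xs| < r2.
  rewrite xE; apply: (@lt_le_trans _ _ r); first by lra.
  by rewrite ge_min lexx orbT.
have xur2 : `|x + u - xs| < r2.
  by apply: lt_le_trans xur _; rewrite ge_min lexx orbT.
have f1 := minxu Fxu.
have uE : x + u - x = u by rewrite addrC addKr.
have := LP x (x + u) xr2 xur2; rewrite uE => f2.
have f3 := ler_norm (f (x + u) - f x).
have f4 : L * `|u| <= L * (C * e) by rewrite ler_wpM2l // ltW.
rewrite -mulrA; lra.
Unshelve. all: by end_near. Qed.

(** Pairing the stationarity equation with the vector dual to [e_i] kills all
    constraint gradients.  The right-hand side mentions neither multipliers nor
    branch, so all branches share the same [eta]. *)
Lemma LICQ_eta_coord xs d b lg lh eta :
    (forall k l, licq_index xs d k -> licq_index xs d l ->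
      dotp (licq_vector xs k) (b l) = (k == l)%:R) ->
    is_multiplier f g h xs d lg lh eta ->
    (forall i, i \in (supp xs :|: supp d)%SET -> eta 0 i = 0) ->
  forall i, i \notin (supp xs :|: supp d)%SET ->
    eta 0 i = - dotp (grad f xs) (b (inr i)).
Proof.
move=> bP [_ _ stat] etaJ i iJ.
have iZ : licq_index xs d (inr i) by rewrite /= -notin_supp.
have := congr1 (fun v => dotp v (b (inr i))) stat.
rewrite /= dotp0l !dotpDl !dotp_suml big1 => [|k kA]; last first.
  have kP : licq_index xs d (inl (inl k)) by move: kA; rewrite inE => /andP[].
  by rewrite dotpZl (bP (inl (inl k)) (inr i) kP iZ) mulr0.
rewrite big1 => [|k _]; last first.
  by rewrite dotpZl (bP (inl (inr k)) (inr i) isT iZ) mulr0.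
rewrite !addr0 => /eqP; rewrite addrC addr_eq0 => /eqP <-.
have bE k : k \notin (supp xs :|: supp d)%SET -> b (inr i) 0 k = (k == i)%:R.
  move=> kJ; have kZ : licq_index xs d (inr k) by rewrite /= -notin_supp.
  by have := bP _ _ kZ iZ; rewrite /= dotpC dotp_basis (inj_eq inr_inj).
rewrite /dotp (bigD1 i) //= big1 ?addr0 => [|k ki].
  by rewrite bE // eqxx mulr1.
have [kJ|kJ] := boolP (k \in (supp xs :|: supp d)%SET).
  by rewrite etaJ // mul0r.
by rewrite bE // (negbTE ki) mulr0.
Qed.

End LICQ.

(** * Points accumulating in a direction *)

Section BadDirections.
Variables (R : realType) (n : nat).
Implicit Types (x xs d v : 'rV[R]_n).

Definition unit_dir xs x := `|x - xs|^-1 *: (x - xs).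

Lemma norm_unit_dir xs x : x != xs -> `|unit_dir xs x| = 1.
Proof.
move=> xne; have n0 : 0 < `|x - xs| by rewrite normr_gt0 subr_eq0.
by rewrite normrZ gtr0_norm ?invr_gt0 // mulVf // gt_eqF.
Qed.

Lemma unit_dirK xs x : x != xs -> x - xs = `|x - xs| *: unit_dir xs x.
Proof.
move=> xne; have n0 : 0 < `|x - xs| by rewrite normr_gt0 subr_eq0.
by rewrite scalerA mulfV ?scale1r // gt_eqF.
Qed.

(** [d] is a cluster point, in the compact unit ball, of the normalized
    displacements; it is nonzero because these have norm one. *)
Lemma accumulation_direction (bad : set 'rV[R]_n) xs :
    (forall r : R, 0 < r -> exists x, [/\ bad x, x != xs & `|x - xs| < r]) ->
  exists2 d, d != 0 & forall r e : R, 0 < r -> 0 < e ->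
    exists x, [/\ bad x, x != xs, `|x - xs| < r & `|unit_dir xs x - d| < e].
Proof.
move=> acc.
(* the sets B r generate the filter of directions of bad points close to [xs] *)
pose B (r : R) := unit_dir xs @` [set x | [/\ bad x, x != xs & `|x - xs| < r]].
pose F := filter_from [set r : R | 0 < r] B.
have PF : ProperFilter F.
  apply: filter_from_proper.
    apply: filter_from_filter; first by exists 1; rewrite /= ltr01.
    move=> r r' /= r0 r'0; exists (Num.min r r'); first by rewrite /= lt_min r0 r'0.
    move=> u [x [bx xne]] /=; rewrite lt_min => /andP[xr xr2] <-.
    by split; exists x.
  by move=> r /= /acc[x xP]; exists (unit_dir xs x), x.
have FA : F [set y | `|y| <= 1].
  exists 1; first by rewrite /= ltr01.
  by move=> _ [x [_ xne _] <-] /=; rewrite norm_unit_dir.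
have [d [_ cld]] := @compact_closed_ball R n 1 F PF FA.
have close (r e : R) : 0 < r -> 0 < e ->
    exists x, [/\ bad x, x != xs, `|x - xs| < r & `|unit_dir xs x - d| < e].
  move=> r0 e0.
  have FB : F (B r) by exists r.
  have [_ [[x [bx xne xr] <-] xd]] := cld _ _ FB (nbhsx_ballx d e e0).
  by exists x; split=> //; move: xd; rewrite -ball_normE /= distrC.
exists d => //; apply/negP => /eqP d0.
have [x [_ xne _]] := close 1 1 ltr01 ltr01.
by rewrite d0 subr0 norm_unit_dir // ltxx.
Qed.

Lemma dotp_unit_dir_close u xs x d (e : R) : x != xs ->
    `|unit_dir xs x - d| < e ->
  `|dotp u (x - xs) - `|x - xs| * dotp u d| <= n%:R * `|u| * e * `|x - xs|.
Proof.
move=> xne xe; rewrite {1}(unit_dirK xne) dotpZr -mulrBr -dotpBr normrM normr_id.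
rewrite mulrC ler_wpM2r //; apply: le_trans (norm_dotp_le _ _) _.
by rewrite -mulrA ler_wpM2l // ler_wpM2l // ltW.
Qed.

(** If the slope along [d] had the opposite sign, it would dominate both the
    linearization error of [F] and the deviation of the direction from [d], and
    impose its sign on the increment at some bad point. *)
Lemma directional_bound (bad : set 'rV[R]_n) xs d (F : 'rV[R]_n -> R) (c : R) :
    twice_diff F ->
    (forall r e : R, 0 < r -> 0 < e ->
      exists x, [/\ bad x, x != xs, `|x - xs| < r & `|unit_dir xs x - d| < e]) ->
    (forall x, bad x -> c * (F x - F xs) <= 0) ->
  c * dotp (grad F xs) d <= 0.
Proof.
move=> [dF ddF] acc H; rewrite leNgt; apply/negP; set a := dotp _ d => a0.
pose k := `|c| + 1; have k0 : 0 < k by apply: ltr_wpDl.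
(* q bounds each of the two errors, so that together, once multiplied by c, they
   amount to at most half of c a *)
pose q := c * a / (4 * k); have q0 : 0 < q by rewrite divr_gt0 // mulr_gt0.
have cF : {for xs, continuous (grad F)} by apply: differentiable_continuous.
have [r r0 rP] := strict_diff dF cF q0.
pose N := n%:R * `|grad F xs| + 1.
have N0 : 0 < N by apply: ltr_wpDl => //; rewrite mulr_ge0.
have e0 : 0 < q / N by rewrite divr_gt0.
have [x [bx xne xr xd]] := acc r (q / N) r0 e0.
have t0 : 0 < `|x - xs| by rewrite normr_gt0 subr_eq0.
have := rP xs (x - xs); rewrite subrr normr0 subrKC => /(_ r0 xr) H1.
have H2 := dotp_unit_dir_close (grad F xs) xne xd; rewrite -/a in H2.
set t := `|x - xs| in t0 xr H1 H2; set D := dotp _ (x - xs) in H1 H2.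
have H3 : n%:R * `|grad F xs| * (q / N) * t <= q * t.
  rewrite ler_wpM2r ?(ltW t0) // mulrCA ler_piMr ?(ltW q0) //.
  by rewrite ler_pdivrMr // mul1r /N lerDl.
have H4 : `|F x - F xs - t * a| <= 2 * q * t.
  have := ler_normD (F x - F xs - D) (D - t * a); rewrite addrA subrK; lra.
have H5 : `|c * (F x - F xs - t * a)| <= k * (2 * q * t).
  by rewrite normrM ler_pM // /k lerDl.
have H6 : k * (2 * q * t) = c * a * t / 2.
  by rewrite /q; field; rewrite gt_eqF.
have := H x bx; have := ler_norm (- (c * (F x - F xs - t * a))).
rewrite normrN; have : 0 < c * a * t by rewrite mulr_gt0.
lra.
Qed.

Lemma norm_mulmx_le v (A : 'M[R]_n) :
  `|v *m A| <= (\sum_i \sum_j `|A i j|) * `|v|.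
Proof.
apply: norm_row_le => [|j].
  by rewrite mulr_ge0 //; apply: sumr_ge0 => i _; exact: sumr_ge0.
rewrite mxE; apply: le_trans (ler_norm_sum _ _ _) _.
rewrite mulr_suml; apply: ler_sum => i _; rewrite normrM mulrC.
apply: ler_pM => //; last exact: norm_coord_le.
by rewrite (bigD1 j) //= lerDl sumr_ge0.
Qed.

Lemma quad_form_close (A : 'M[R]_n) u d (e : R) : `|u| <= 1 -> `|u - d| <= e ->
  quad_form A d - n%:R * (\sum_i \sum_j `|A i j|) * (1 + `|d|) * e <= quad_form A u.
Proof.
move=> u1 ue; set C := \sum_i _.
have C0 : 0 <= C by apply: sumr_ge0 => i _; exact: sumr_ge0.
have e0 : 0 <= e := le_trans (normr_ge0 _) ue.
have E : quad_form A u - quad_form A d = dotp ((u - d) *m A) u + dotp (d *m A) (u - d).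
  by rewrite /quad_form mulmxBl dotpBl dotpBr; ring.
have H1 : `|dotp ((u - d) *m A) u| <= n%:R * C * e.
  apply: le_trans (norm_dotp_le _ _) _; rewrite -mulrA ler_wpM2l //.
  rewrite -[leRHS]mulr1 ler_pM //; apply: le_trans (norm_mulmx_le _ _) _.
  by rewrite ler_wpM2l.
have H2 : `|dotp (d *m A) (u - d)| <= n%:R * C * `|d| * e.
  apply: le_trans (norm_dotp_le _ _) _; rewrite -!mulrA ler_wpM2l //.
  by rewrite mulrA ler_pM //; exact: norm_mulmx_le.
have := ler_norm (- dotp ((u - d) *m A) u).
have := ler_norm (- dotp (d *m A) (u - d)); rewrite !normrN; lra.
Qed.

End BadDirections.

(** * Second-order sufficient condition *)

Section Sufficiency.
Variables (R : realType) (n m p s : nat).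
Variables (f : 'rV[R]_n -> R) (g : 'rV[R]_n -> 'rV[R]_m)
          (h : 'rV[R]_n -> 'rV[R]_p).
Hypotheses (hf : C2 f) (hg : C2_map g) (hh : C2_map h) (hs : (s < n)%N).
Implicit Types (x xs d : 'rV[R]_n).

(** Coordinates in [supp xs] stay nonzero by closeness to [xs].  Those in
    [supp d] only are zero at [xs], and closeness of the direction to [d] makes
    their displacement nonzero. *)
Lemma supp_stable xs d : exists r e : R, [/\ 0 < r, 0 < e &
  forall x, x != xs -> `|x - xs| < r -> `|unit_dir xs x - d| < e ->
    (supp xs :|: supp d)%SET \subset supp x].
Proof.
have low (v : 'rV[R]_n) : exists2 r : R, 0 < r & forall i, i \in supp v -> r <= `|v 0 i|.
  have H : \forall r \near (0 : R)^'+, forall i, i \in supp v -> r <= `|v 0 i|.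
    apply: filter_forall => i; have [iv|iv] := boolP (i \in supp v).
      near=> r => _; apply: ltW; near: r; apply: nbhs_right_lt.
      by rewrite normr_gt0; move: iv; rewrite inE.
    by near=> r.
  by have [r [r0 rP]] := filter_ex (filterI (nbhs_right_gt (0 : R)) H); exists r.
have [r r0 rP] := low xs; have [e e0 eP] := low d.
exists r, e; split => // x xne xr xe; apply/fintype.subsetP => i iJ.
rewrite inE; apply/negP => /eqP xi.
have [ixs|ixs] := boolP (i \in supp xs).
  have := le_lt_trans (norm_coord_le (x - xs) i) xr.
  by rewrite !mxE xi sub0r normrN ltNge rP.
have idd : i \in supp d by move: iJ; rewrite finset.in_setU (negbTE ixs).
have xsi : xs 0 i = 0 by apply/eqP; move: ixs; rewrite inE negbK.
have := le_lt_trans (norm_coord_le (unit_dir xs x - d) i) xe.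
by rewrite /unit_dir !mxE xi xsi subr0 mulr0 sub0r normrN ltNge eP.
Unshelve. all: by end_near. Qed.

(** Feasible points of no larger objective accumulating in a direction [d] make
    [d] critical by first-order limits.  At these points the Lagrangian is at
    most its value at [xs], where its gradient is [- eta].  This vector is
    orthogonal to the displacements: either it is zero, or the supports of the
    points, which contain [supp xs :|: supp d] and have at most [s] elements,
    equal that set.  Taylor expansion then bounds the curvature along [d] from
    above by an arbitrarily small number. *)
Lemma second_order_sufficient xs : feasible_set s g h xs ->
    (forall d, d <> 0 -> critical_cone s f g h xs d ->
      exists lg lh eta, S_multiplier s f g h xs d lg lh eta /\
        0 < quad_form (hess (lagrangian f g h lg lh) xs) d) ->
  strict_local_minimizer s f g h xs.
Proof.
move=> Fxs H; split=> //; apply: contrapT => notmin.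
have [gxs hxs _] := Fxs.
pose bad := [set x | feasible_set s g h x /\ f x <= f xs].
have acc0 (r : R) : 0 < r -> exists x, [/\ bad x, x != xs & `|x - xs| < r].
  move=> r0; apply: contrapT => none; apply: notmin; apply/nbhs_normP.
  exists r => // x /= xr Fx /eqP xne; rewrite ltNge; apply/negP => fx.
  by apply: none; exists x; split => //; rewrite distrC.
have [d d0 acc] := accumulation_direction acc0.
have tf : twice_diff f by case: hf.
have tg i : twice_diff (component g i) by case: (hg i).
have th i : twice_diff (component h i) by case: (hh i).
have [r1 [e1 [r10 e10 suppP]]] := supp_stable xs d.
have Js : (#|(supp xs :|: supp d)%SET| <= s)%N.
  have [x [[[_ _ xs0] _] xne xr xe]] := acc r1 e1 r10 e10.
  by apply: leq_trans xs0; apply: subset_leq_card; exact: suppP.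
have dC : critical_cone s f g h xs d.
  split=> [i|i||].
  - rewrite inE => /eqP gi; rewrite -[leLHS]mul1r.
    apply: (directional_bound (tg i) acc) => x [[gx _ _] _].
    by rewrite mul1r gi subr0.
  - have H1 : 1 * dotp (grad (component h i) xs) d <= 0.
      apply: (directional_bound (th i) acc) => x [[_ hx _] _].
      by rewrite hx hxs subrr mulr0.
    have H2 : -1 * dotp (grad (component h i) xs) d <= 0.
      apply: (directional_bound (th i) acc) => x [[_ hx _] _].
      by rewrite hx hxs subrr mulr0.
    by apply/eqP; rewrite eq_le; apply/andP; split; lra.
  - have [|I JI cI] := @set_extension _ (supp xs :|: supp d)%SET s.
      by rewrite Js card_ord ltnW.
    exists I; split => //.
      by apply: fintype.subset_trans JI; exact: finset.subsetUl.
    by rewrite coord_space_supp; apply: fintype.subset_trans JI; exact: finset.subsetUr.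
  - rewrite -[leLHS]mul1r; apply: (directional_bound tf acc) => x [_ fx].
    by rewrite mul1r subr_le0.
have [lg [lh [eta [[[lg0 lgN stat] etaJ etas] qpos]]]] := H d (elimN eqP d0) dC.
have [tL gL _] := lagrangian_expand lg lh hf hg hh.
set LL := lagrangian f g h lg lh in qpos tL gL.
set q := quad_form _ _ in qpos.
have gLeta : grad LL xs = - eta.
  apply/eqP; rewrite -addr_eq0 gL; apply/eqP; rewrite -[RHS]stat; congr (_ + _ + _ + _).
  rewrite (bigID (mem (active_dir g xs d))) /= [X in _ + X]big1 ?addr0 // => i iA.
  by rewrite lgN // scale0r.
have q8 : 0 < q / 8 by rewrite divr_gt0.
have [r2 r20 taylor] := taylor2 xs tL q8.
pose D := n%:R * (\sum_i \sum_j `|hess LL xs i j|) * (1 + `|d|).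
pose C := D + 1.
have C0 : 0 < C.
  apply: ltr_wpDl => //; rewrite !mulr_ge0 ?addr_ge0 //.
  by apply: sumr_ge0 => i _; exact: sumr_ge0.
have e20 : 0 < Num.min e1 (q / (2 * C)).
  by rewrite lt_min e10 divr_gt0 // mulr_gt0.
have r30 : 0 < Num.min r1 r2 by rewrite lt_min r10.
have [x [[Fx fx] xne]] := acc _ _ r30 e20.
rewrite !lt_min => /andP[xr1 xr2] /andP[xe1 xe2].
have [gx hx xcard] := Fx.
have JX := suppP x xne xr1 xe1.
have etax : dotp eta (x - xs) = 0.
  have [Jlt|Jge] := ltnP #|(supp xs :|: supp d)%SET| s.
    by rewrite etas // dotp0l.
  have Jeq : #|(supp xs :|: supp d)%SET| = s by apply/eqP; rewrite eqn_leq Js.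
  have /eqP suppE : (supp xs :|: supp d)%SET == supp x.
    by rewrite eqEcard JX (leq_trans xcard).
  rewrite /dotp big1 // => i _.
  have [iJ|iJ] := boolP (i \in (supp xs :|: supp d)%SET).
    by rewrite etaJ // mul0r.
  have xi : x 0 i = 0 by move: iJ; rewrite suppE inE negbK => /eqP.
  have xsi : xs 0 i = 0.
    by move: iJ; rewrite finset.in_setU negb_or inE negbK => /andP[/eqP].
  by rewrite !mxE xi xsi subrr mulr0.
have Lle : LL x <= LL xs.
  rewrite /LL /lagrangian; apply: lerD; first apply: lerD => //.
    apply: ler_sum => i _; have [iA|iA] := boolP (i \in active_dir g xs d).
      move: (iA); rewrite inE => /andP[]; rewrite inE => /eqP gi _.
      have -> : g xs 0 i = 0 by exact: gi.
      by rewrite mulr0 mulr_ge0_le0 ?lg0 //; exact: gx.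
    by rewrite lgN // !mul0r.
  rewrite /dotp !big1 // => i _.
    by rewrite (_ : h xs 0 i = 0) ?mulr0 //; exact: hxs.
  by rewrite (_ : h x 0 i = 0) ?mulr0 //; exact: hx.
have := taylor (x - xs) xr2; rewrite subrKC gLeta dotpNl etax oppr0 subr0.
have t0 : 0 < `|x - xs| by rewrite normr_gt0 subr_eq0.
have u1 : `|unit_dir xs x| <= 1 by rewrite norm_unit_dir.
have quadE : quad_form (hess LL xs) (x - xs) =
    `|x - xs| ^+ 2 * quad_form (hess LL xs) (unit_dir xs x).
  rewrite {1}(unit_dirK xne) /quad_form -scalemxAl dotpZl dotpZr; ring.
have := quad_form_close (hess LL xs) u1 (ltW xe2); rewrite -/q -/D quadE.
set Q := quad_form _ (unit_dir xs x); set t2 := `|x - xs| ^+ 2.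
have t20 : 0 < t2 by rewrite exprn_gt0.
have : D * (q / (2 * C)) <= q / 2.
  rewrite (_ : q / 2 = C * (q / (2 * C))); last by field; rewrite gt_eqF.
  rewrite ler_wpM2r ?lerDl // ltW // divr_gt0 // mulr_gt0 //.
move=> HD HQ; rewrite ler_norml => /andP[HL _].
have : t2 * (q / 2) <= t2 * Q by rewrite ler_pM2l //; lra.
have : 0 < t2 * q by rewrite mulr_gt0.
lra.
Qed.

End Sufficiency.

(** * Second-order necessary conditions *)

Section Necessity.
Variables (R : realType) (n m p s : nat).
Variables (f : 'rV[R]_n -> R) (g : 'rV[R]_n -> 'rV[R]_m)
          (h : 'rV[R]_n -> 'rV[R]_p).
Hypotheses (hf : C2 f) (hg : C2_map g) (hh : C2_map h) (hs : (s < n)%N).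
Implicit Types (xs d : 'rV[R]_n).

Lemma MSCQ_necessary xs d : local_minimizer s f g h xs ->
    critical_cone s f g h xs d -> MSCQ s g h xs d ->
  exists lg lh eta, M_multiplier s f g h xs d lg lh eta /\
    0 <= quad_form (hess (lagrangian f g h lg lh) xs) d.
Proof.
move=> loc dC mscq; have [_ _ [I [xI cI dI]] _] := dC.
have pen := MSCQ_branch_penalty hf loc mscq xI cI.
have [lg [lh [eta [mul etaI soc]]]] := penalty_multiplier hf hg hh loc.1 dC dI pen.
exists lg, lh, eta; split=> //; split=> // [i|].
  rewrite finset.in_setU => /orP[/(fintype.subsetP xI)/etaI //|iD]; apply: etaI.
  by move: dI; rewrite coord_space_supp => /fintype.subsetP; apply.
apply: (@leq_trans #|(~: I)%SET|); last by rewrite cardsCs finset.setCK card_ord cI.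
apply: subset_leq_card; apply/fintype.subsetP => i; rewrite inE finset.in_setC.
by apply: contra_neqN => /etaI.
Qed.

(** When the two supports have fewer than [s] elements, an index [i] outside them
    can be added to form a branch; its [eta] vanishes at [i] and coincides with
    the one at hand. *)
Lemma LICQ_necessary xs d : local_minimizer s f g h xs ->
    critical_cone s f g h xs d -> CCOP_LICQ g h xs d ->
  exists lg lh eta, S_multiplier s f g h xs d lg lh eta /\
    0 <= quad_form (hess (lagrangian f g h lg lh) xs) d.
Proof.
move=> loc dC licq; have [_ _ [I0 [xI0 cI0 dI0]] _] := dC.
set J := (supp xs :|: supp d)%SET.
have JI0 : J \subset I0 by rewrite finset.subUset xI0 -coord_space_supp.
have branch (I : {set 'I_n}) : J \subset I -> #|I| = s ->
    exists lg lh eta, [/\ is_multiplier f g h xs d lg lh eta,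
      forall i, i \in I -> eta 0 i = 0
      & 0 <= quad_form (hess (lagrangian f g h lg lh) xs) d].
  move=> JI cI; have dI : d \in coord_space R I.
    by rewrite coord_space_supp; apply: fintype.subset_trans JI; exact: finset.subsetUr.
  have pen := LICQ_branch_penalty hf hg hh loc licq JI cI.
  exact: penalty_multiplier hf hg hh loc.1 dC dI pen.
have [lg [lh [eta [mul etaI soc]]]] := branch I0 JI0 cI0.
have etaJ i : i \in J -> eta 0 i = 0 by move=> /(fintype.subsetP JI0)/etaI.
exists lg, lh, eta; split=> //; split=> // Jlt.
have [b bP] := LICQ_dual licq.
apply/rowP => i; rewrite mxE.
have [/etaJ //|iJ] := boolP (i \in J).
have [|I JI cI] := @set_extension _ (i |: J) s.
  by rewrite cardsU1 iJ add1n Jlt card_ord ltnW.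
have [iI JI'] : i \in I /\ J \subset I.
  split; first by apply: (fintype.subsetP JI); rewrite setU11.
  by apply: fintype.subset_trans JI; exact: subsetU1.
have [lg' [lh' [eta' [mul' etaI' _]]]] := branch I JI' cI.
have etaJ' k : k \in J -> eta' 0 k = 0 by move=> /(fintype.subsetP JI')/etaI'.
rewrite (LICQ_eta_coord bP mul etaJ iJ) -(LICQ_eta_coord bP mul' etaJ' iJ).
exact: etaI'.
Qed.
End Necessity.

Theorem theorem4p1 (R : realType) (n m p s : nat)
    (f : 'rV[R]_n -> R) (g : 'rV[R]_n -> 'rV[R]_m) (h : 'rV[R]_n -> 'rV[R]_p)
    (hf : C2 f) (hg : C2_map g) (hh : C2_map h) (hs : (s < n)%N) :
  (forall xs : 'rV[R]_n, local_minimizer s f g h xs ->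
     (forall d : 'rV[R]_n, critical_cone s f g h xs d -> MSCQ s g h xs d ->
        M_stationary s f g h xs d /\
        exists lg lh eta, M_multiplier s f g h xs d lg lh eta /\
          0 <= quad_form (hess (lagrangian f g h lg lh) xs) d) /\
     (forall d : 'rV[R]_n, critical_cone s f g h xs d -> CCOP_LICQ g h xs d ->
        exists lg lh eta, S_multiplier s f g h xs d lg lh eta /\
          0 <= quad_form (hess (lagrangian f g h lg lh) xs) d)) /\
  (forall xs : 'rV[R]_n, feasible_set s g h xs ->
     (forall d : 'rV[R]_n, d <> 0 -> critical_cone s f g h xs d ->
        exists lg lh eta, S_multiplier s f g h xs d lg lh eta /\
          0 < quad_form (hess (lagrangian f g h lg lh) xs) d) ->
     strict_local_minimizer s f g h xs).
Proof.
split=> [xs loc|xs]; last exact: second_order_sufficient.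
split=> d dC; last exact: LICQ_necessary.
move=> mscq; have [lg [lh [eta [M soc]]]] := MSCQ_necessary hf hg hh loc dC mscq.
by split; exists lg, lh, eta.
Qed.
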